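(* Let $M$ be a $(2n+1)$-dimensional smooth manifold with a Legendrean contact structure $H=E\oplus F\subset TM$ and let $Q=TM/H$. For every section $\rho$ of $Q$ there exists a unique section $t$ of $TM/F$ such that $\pi_Q(t)=\rho$ and $\partial^*\nabla^{TM/F}t=0$. This gives rise to a first-order differential operator $S:\Gamma(Q)\to\Gamma(TM/F)$, $\rho\mapsto S(\rho):=t$; in the splitting corresponding to a contact form $\theta\in\Omega^1(M)$ it is given by $(S(\rho))_\theta=(\rho,\nabla^Q\rho)^{\intercal}$.
   Context: A contact structure on a smooth $(2n+1)$-manifold $M$ is a corank-one subbundle $H\subset TM$ such that, with $Q:=TM/H$ and projection $\pi_Q:TM\to Q$ (which also descends to $TM/F$), the Levi bracket $\mathcal{L}:\Lambda^2H\to Q$, $\mathcal{L}(\eta,\xi)=\pi_Q([\eta,\xi])$ for $\eta,\xi\in\Gamma(H)$, is nondegenerate. A Legendrean contact structure is a splitting $H=E\oplus F$ into two rank-$n$ subbundles with $\mathcal{L}|_{E\times E}=0$ and $\mathcal{L}|_{F\times F}=0$. A lower index $E$ or $F$ on a section of $H$ denotes its component in $E$ or $F$. A contact form is $\theta\in\Omega^1(M)$ with $\ker\theta=H$ (contact forms are assumed to exist); it descends to $Q$. The Reeb vector field $r$ of $\theta$ is the unique vector field with $\theta(r)=1$, $\iota_r d\theta=0$; for $\xi\in\Gamma(H)$ one has $[\xi,r]\in\Gamma(H)$. The contact form induces an isomorphism (''splitting'') $\Gamma(TM/F)\to\Gamma(Q\oplus E)$, $t+F\mapsto (t)_\theta:=\big(\pi_Q(t),(t-\theta(t)r)_E\big)^{\intercal}$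 for $t\in\Gamma(TM)$. Given $\theta$, for $\xi\in\Gamma(F)$ put $\nabla^Q_\xi\rho=(\xi\cdot\theta(\rho))\pi_Q(r)$ for $\rho\in\Gamma(Q)$ and $\nabla^E_\xi\eta=([\xi,\eta]-\theta([\xi,\eta])r)_E$ for $\eta\in\Gamma(E)$. The partial connection $\nabla^{TM/F}$ on $TM/F$ in $F$-directions is given, in the splitting $(t)_\theta=(\rho,\mu)^{\intercal}$ determined by a contact form $\theta$ (any contact form may be used), by $$(\nabla^{TM/F}_\xi t)_\theta=\big(\nabla^Q_\xi\rho+\mathcal{L}(\xi,\mu),\ \nabla^E_\xi\mu+\theta(\rho)[\xi,r]_E\big)^{\intercal},$$ so that $\nabla^{TM/F}t\in\Gamma(F^*\otimes TM/F)$. There is a bundle isomorphism $E\to F^*\otimes Q$, $\eta\mapsto\mathcal{L}(\eta,\cdot)|_F$. The section $\nabla^Q\rho\in\Gamma(F^*\otimes Q)$ is viewed via this isomorphism as a section of $E$, namely the $\mu$ with $\mathcal{L}(\mu,\xi)=\nabla^Q_\xi\rho$ for all $\xi\in\Gamma(F)$. The map $\partial^*:F^*\otimes TM/F\to TM/F$ is the composition of $\mathrm{id}_{F^*}\otimes\pi_Q:F^*\otimes TM/F\to F^*\otimes Q$, the inverse isomorphism $F^*\otimes Q\to E$, and the natural inclusion $E\hookrightarrow TM/F$. *)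

(* Defs.v *)
From HB Require Import structures.
From mathcomp Require Import all_boot all_order all_algebra.
From mathcomp Require Import all_classical all_reals all_analysis.
Import Order.TTheory GRing.Theory Num.Theory.
Import numFieldNormedType.Exports.

Set Implicit Arguments.
Unset Strict Implicit.
Unset Printing Implicit Defensive.

Local Open Scope classical_set_scope.
Local Open Scope ring_scope.

(** * Smooth manifolds *)

(* Iterated continuous partial derivatives on [U], meant for [U] open: then
   values outside [U] play no role. *)
Fixpoint Ck {R : realType} {d : nat} (k : nat) (U : set 'rV[R]_d)
    (f : 'rV[R]_d -> R) : Prop :=
  (forall x, U x -> {for x, continuous f}) /\
  if k is k'.+1 then
    forall i : 'I_d,
      (forall x, U x -> derivable f x (delta_mx 0 i)) /\
      Ck k' U (fun x => 'D_(delta_mx 0 i) f x)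
  else True.

Definition Cinfty {R : realType} {d : nat} (U : set 'rV[R]_d)
    (f : 'rV[R]_d -> R) : Prop := forall k, Ck k U f.

(* Charts are total functions; [cmap] matters on [cdom] only and [cinv] on
   the image of [cdom] only. *)
Record chart (R : realType) (d : nat) (M : topologicalType) := Chart {
  cdom : set M;
  cmap : M -> 'rV[R]_d;
  cinv : 'rV[R]_d -> M;
  cdom_open : open cdom;
  cimg_open : open (cmap @` cdom);
  cmapK : forall p, cdom p -> cinv (cmap p) = p;
  cmap_continuous : forall p, cdom p -> {for p, continuous cmap};
  cinv_continuous : forall x, (cmap @` cdom) x -> {for x, continuous cinv}
}.

Definition chart_compatible {R : realType} {d : nat} {M : topologicalType}
    (a b : chart R d M) : Prop :=
  forall i : 'I_d,
    Cinfty (cmap a @` (cdom a `&` cdom b)) (fun x => cmap b (cinv a x) 0 i).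

Record manifold (R : realType) (d : nat) := Manifold {
  manifold_carrier :> topologicalType;
  atlas : set (chart R d manifold_carrier);
  manifold_hausdorff : hausdorff_space manifold_carrier;
  manifold_countable : @second_countable manifold_carrier;
  atlas_cover : forall p, exists2 a, atlas a & cdom a p;
  atlas_compatible : forall a b, atlas a -> atlas b -> chart_compatible a b
}.

(* [f] is smooth on some neighbourhood of [p]. *)
Definition smooth_at {R : realType} {d : nat} {M : manifold R d}
    (f : M -> R) (p : M) : Prop :=
  exists U : set M, [/\ open U, U p &
    forall a, atlas a -> Cinfty (cmap a @` (U `&` cdom a)) (f \o cinv a)].

Definition smooth_fun {R : realType} {d : nat} {M : manifold R d}
    (f : M -> R) : Prop :=
  forall p, smooth_at f p.

(** * Tangent vectors and vector fields *)

(* T_p M is the space of derivations of smooth germs at [p], as a subset of the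
   vector space of all functionals on M -> R. The last clause makes the
   functional determined by the derivation. *)
Record tangent {R : realType} {d : nat} {M : manifold R d} (p : M)
    (v : (M -> R) -> R) : Prop := Tangent {
  tangent_germ : forall f g, smooth_at f p -> smooth_at g p ->
    (\forall q \near p, f q = g q) -> v f = v g;
  tangent_linear : forall (c : R) f g, smooth_at f p -> smooth_at g p ->
    v (c *: f + g) = c * v f + v g;
  tangent_leibniz : forall f g, smooth_at f p -> smooth_at g p ->
    v (f * g) = f p * v g + g p * v f;
  tangent_default : forall f, ~ smooth_at f p -> v f = 0
}.

(* A (rough) vector field assigns to every point a functional. *)
Notation vfield R M := (M -> (M -> R) -> R).

Definition vf_app {R : realType} {d : nat} {M : manifold R d}
    (X : vfield R M) (f : M -> R) : M -> R := fun q => X q f.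

(* [X] is a smooth vector field on some neighbourhood of [p]. *)
Definition smooth_vf_at {R : realType} {d : nat} {M : manifold R d}
    (X : vfield R M) (p : M) : Prop :=
  \forall q \near p, tangent q (X q) /\
    forall f, smooth_at f q -> smooth_at (vf_app X f) q.

(* Meaningful at the points near which [X] and [Y] are smooth. *)
Definition vbracket {R : realType} {d : nat} {M : manifold R d}
    (X Y : vfield R M) : vfield R M :=
  fun p f => if `[< smooth_at f p >] then X p (vf_app Y f) - Y p (vf_app X f)
             else 0.

(** * Distributions, quotient bundles and their sections *)

(* A family of subsets of the tangent spaces. *)
Notation tfamily R M := (M -> set ((M -> R) -> R)).

(* [D] has rank [k] : there is a smooth local frame of TM whose first [k]
   members span [D]. *)
Definition subbundle {R : realType} {d : nat} {M : manifold R d} (k : nat)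
    (D : tfamily R M) : Prop :=
  forall p, exists X : 'I_d -> vfield R M,
    (forall i, smooth_vf_at (X i) p) /\
    \forall q \near p,
      (forall v, tangent q v ->
         exists! c : 'rV[R]_d, v = \sum_(i < d) c 0 i *: X i q) /\
      D q = [set v | exists c : 'rV[R]_d,
                       v = \sum_(i < d | (i < k)%N) c 0 i *: X i q].

Definition dsection_at {R : realType} {d : nat} {M : manifold R d}
    (D : tfamily R M) (X : vfield R M) (p : M) : Prop :=
  smooth_vf_at X p /\ \forall q \near p, D q (X q).

Definition dsection {R : realType} {d : nat} {M : manifold R d}
    (D : tfamily R M) (X : vfield R M) : Prop :=
  forall p, smooth_vf_at X p /\ D p (X p).

(* Elements of the fibre at [p] of TM/D are the cosets [tcoset (D p) v]. *)
Definition tcoset {V : zmodType} (A : set V) (v : V) : set V :=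
  [set w | A (w - v)].

Definition coset_add {V : zmodType} (C C' : set V) : set V :=
  [set u + v | u in C & v in C'].

Definition coset_scale {R : realType} {V : lmodType R} (A : set V) (c : R)
    (C : set V) : set V := [set w | exists2 v, C v & A (w - c *: v)].

(* A representative, for nonempty [C]. *)
Definition coset_repr {R : realType} {M : Type}
    (C : set ((M -> R) -> R)) : (M -> R) -> R := xget 0 C.

(* Smooth sections of TM/D. *)
Definition qsection {R : realType} {d : nat} {M : manifold R d}
    (D : tfamily R M) (t : tfamily R M) : Prop :=
  forall p, exists2 X : vfield R M, smooth_vf_at X p &
    \forall q \near p, t q = tcoset (D q) (X q).

Definition qadd {R : realType} {d : nat} {M : manifold R d}
    (t u : tfamily R M) : tfamily R M := fun p => coset_add (t p) (u p).

Definition qscale {R : realType} {d : nat} {M : manifold R d}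
    (D : tfamily R M) (f : M -> R) (t : tfamily R M) : tfamily R M :=
  fun p => coset_scale (D p) (f p) (t p).

(* R-linear operators from sections of TM/D to sections of TM/D' that satisfy
   [[S, f], g] = 0 for all smooth functions [f] and [g], i.e. differential
   operators of order at most one; the commutator identity is stated without
   subtraction. *)
Record first_order_operator {R : realType} {d : nat} {M : manifold R d}
    (D D' : tfamily R M) (S : tfamily R M -> tfamily R M) : Prop :=
  FirstOrderOperator {
  op_section : forall t, qsection D t -> qsection D' (S t);
  op_linear : forall (c : R) t u, qsection D t -> qsection D u ->
    S (qadd (qscale D (fun=> c) t) u) = qadd (qscale D' (fun=> c) (S t)) (S u);
  op_order : forall (f g : M -> R) t,
    smooth_fun f -> smooth_fun g -> qsection D t ->
    qadd (S (qscale D (f * g) t)) (qscale D' (f * g) (S t))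
    = qadd (qscale D' f (S (qscale D g t))) (qscale D' g (S (qscale D f t)))
}.

(** * Legendrean contact structures *)

(* The Levi bracket with values in Q = TM/H, on sections of [H]. *)
Definition levi {R : realType} {d : nat} {M : manifold R d} (H : tfamily R M)
    (eta xi : vfield R M) : tfamily R M :=
  fun p => tcoset (H p) (vbracket eta xi p).

Record contact_structure {R : realType} {n : nat}
    {M : manifold R (2 * n).+1} (H : tfamily R M) : Prop := ContactStructure {
  contact_corank1 : subbundle (2 * n) H;
  contact_nondegenerate : forall p eta, dsection_at H eta p ->
    (forall xi, dsection_at H xi p -> levi H eta xi p = tcoset (H p) 0) ->
    eta p = 0
}.

Record legendrean (R : realType) (n : nat) (M : manifold R (2 * n).+1) :=
  Legendrean {
  LH : tfamily R M;
  LE : tfamily R M;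
  LF : tfamily R M;
  LH_contact : contact_structure LH;
  LE_subbundle : subbundle n LE;
  LF_subbundle : subbundle n LF;
  L_sum : forall p, LH p = [set u + v | u in LE p & v in LF p];
  L_direct : forall p, LE p `&` LF p = [set 0];
  LE_isotropic : forall p eta xi, dsection_at LE eta p -> dsection_at LE xi p ->
    levi LH eta xi p = tcoset (LH p) 0;
  LF_isotropic : forall p eta xi, dsection_at LF eta p -> dsection_at LF xi p ->
    levi LH eta xi p = tcoset (LH p) 0
}.

(* The component v_E of [v] in [LH L p]. *)
Definition compE {R : realType} {n : nat} {M : manifold R (2 * n).+1}
    (L : legendrean M) (p : M) (v : (M -> R) -> R) : (M -> R) -> R :=
  xget 0 [set u | LE L p u /\ LF L p (v - u)].

(* pi_Q : TM/F -> Q. *)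
Definition piQ {R : realType} {n : nat} {M : manifold R (2 * n).+1}
    (L : legendrean M) (t : tfamily R M) : tfamily R M :=
  fun p => tcoset (LH L p) (coset_repr (t p)).

(* One-forms are functions on vector fields pointwise; the values on
   functionals that are not tangent vectors play no role. *)
Notation oneform R M := (M -> ((M -> R) -> R) -> R).

Definition form_app {R : realType} {d : nat} {M : manifold R d}
    (theta : oneform R M) (X : vfield R M) : M -> R := fun q => theta q (X q).

Record smooth_form {R : realType} {d : nat} {M : manifold R d}
    (theta : oneform R M) : Prop := SmoothForm {
  form_linear : forall p (c : R) u v, tangent p u -> tangent p v ->
    theta p (c *: u + v) = c * theta p u + theta p v;
  form_smooth : forall X p, smooth_vf_at X p -> smooth_at (form_app theta X) p
}.

Definition dform {R : realType} {d : nat} {M : manifold R d}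
    (theta : oneform R M) (X Y : vfield R M) : M -> R :=
  fun p => X p (form_app theta Y) - Y p (form_app theta X)
           - theta p (vbracket X Y p).

Record contact_form {R : realType} {n : nat} {M : manifold R (2 * n).+1}
    (L : legendrean M) (theta : oneform R M) : Prop := ContactForm {
  contact_form_smooth : smooth_form theta;
  contact_form_ker : forall p v, tangent p v -> (theta p v = 0 <-> LH L p v)
}.

Definition is_reeb {R : realType} {d : nat} {M : manifold R d}
    (theta : oneform R M) (r : vfield R M) : Prop :=
  [/\ forall p, smooth_vf_at r p,
      forall p, theta p (r p) = 1 &
      forall p Y, smooth_vf_at Y p -> dform theta r Y p = 0].

(* The unique Reeb field, when [theta] is a contact form. *)
Definition reeb {R : realType} {d : nat} {M : manifold R d}
    (theta : oneform R M) : vfield R M := xget 0 [set r | is_reeb theta r].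

(* theta as a map from sections of Q to functions. *)
Definition form_Q {R : realType} {d : nat} {M : manifold R d}
    (theta : oneform R M) (rho : tfamily R M) : M -> R :=
  fun p => theta p (coset_repr (rho p)).

(* The splitting of v + F in Q + E, for a tangent vector [v] at [p]. *)
Definition split_vec {R : realType} {n : nat} {M : manifold R (2 * n).+1}
    (L : legendrean M) (theta : oneform R M) (p : M) (v : (M -> R) -> R) :
    set ((M -> R) -> R) * ((M -> R) -> R) :=
  (tcoset (LH L p) v, compE L p (v - theta p v *: reeb theta p)).

Definition split_TF {R : realType} {n : nat} {M : manifold R (2 * n).+1}
    (L : legendrean M) (theta : oneform R M) (t : tfamily R M) (p : M) :
    set ((M -> R) -> R) * ((M -> R) -> R) :=
  split_vec L theta p (coset_repr (t p)).

(** * Partial connections in F-directions *)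

(* A section of F^* (x) V is encoded by its action xi |-> Phi xi, where
   [Phi xi p] is meaningful for the local sections [xi] of F near [p]. *)

Definition nablaQ {R : realType} {n : nat} {M : manifold R (2 * n).+1}
    (L : legendrean M) (theta : oneform R M) (rho : tfamily R M)
    (xi : vfield R M) : tfamily R M :=
  fun p => tcoset (LH L p) (xi p (form_Q theta rho) *: reeb theta p).

Definition nablaE {R : realType} {n : nat} {M : manifold R (2 * n).+1}
    (L : legendrean M) (theta : oneform R M) (eta xi : vfield R M) :
    vfield R M :=
  fun p => compE L p (vbracket xi eta p
                      - theta p (vbracket xi eta p) *: reeb theta p).

(* The class in T_pM/F_p whose splitting is the prescribed one. The tangent
   vectors with a given splitting form exactly one coset of F_p, which is how
   elements of T_pM/F_p are encoded. *)
Definition nablaTF {R : realType} {n : nat} {M : manifold R (2 * n).+1}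
    (L : legendrean M) (theta : oneform R M) (t : tfamily R M)
    (xi : vfield R M) : tfamily R M :=
  let rho := fun q => (split_TF L theta t q).1 in
  let mu := fun q => (split_TF L theta t q).2 in
  fun p => [set v | tangent p v /\
    split_vec L theta p v =
      (coset_add (nablaQ L theta rho xi p) (levi (LH L) xi mu p),
       nablaE L theta mu xi p
       + form_Q theta rho p *: compE L p (vbracket xi (reeb theta) p))].

(* The inverse of the isomorphism E -> F^* (x) Q, eta |-> levi eta, on
   sections. *)
Definition levi_inv {R : realType} {n : nat} {M : manifold R (2 * n).+1}
    (L : legendrean M) (Phi : vfield R M -> tfamily R M) : vfield R M :=
  xget 0 [set mu | dsection (LE L) mu /\
    forall p xi, dsection_at (LF L) xi p -> levi (LH L) mu xi p = Phi xi p].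

(* The map induced on sections by F^* (x) TM/F -> F^* (x) Q -> E -> TM/F. *)
Definition dstar {R : realType} {n : nat} {M : manifold R (2 * n).+1}
    (L : legendrean M) (Phi : vfield R M -> tfamily R M) : tfamily R M :=
  fun p => tcoset (LF L p) (levi_inv L (fun xi => piQ L (Phi xi)) p).

(* Main.v *)
Require Import Defs.
From HB Require Import structures.
From mathcomp Require Import all_boot all_order all_algebra.
From mathcomp Require Import all_classical all_reals all_analysis.
From mathcomp Require Import ring.
Import Order.TTheory GRing.Theory Num.Theory.
Import numFieldNormedType.Exports.

Set Implicit Arguments.
Unset Strict Implicit.
Unset Printing Implicit Defensive.

Local Open Scope classical_set_scope.
Local Open Scope ring_scope.

(** A lift of a section [rho] of Q to TM/F, locally the class of a vector field
    [X], has vanishing [dstar (nablaTF _)] iff [[X, xi]] lies in H for all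
    sections [xi] of F: writing [X = f r + mu] modulo F with [f] the function
    given by [rho], one finds [theta ([X, xi]) = theta ([mu, xi]) - xi f] because
    the Reeb field [r] satisfies [theta ([r, xi]) = 0]. The condition determines
    [mu] by nondegeneracy and isotropy, and as it mentions no contact form the
    resulting operator does not depend on one; linearity and the order of the
    operator also follow from it by uniqueness.

    Coordinates and Hadamard's lemma are avoided: smoothness of coefficients
    with respect to a frame follows from Cramer's rule, after testing the frame
    against smooth functions dual to it at a point. The same rule solves the
    linear systems for the Reeb field and for the inverse of the Levi bracket
    locally, and pointwise uniqueness glues the local solutions. *)

(** * Smooth functions *)

(** Fields, sections and functions are total, and smoothness is asked only near a point, so local
    sections need neither restriction nor bump functions. The price is that a bracket at [p] depends
    on germs, whereas nondegeneracy concludes about values at [p]; agreement is therefore carried on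
    neighbourhoods and evaluated last. The scalar theta([X, Y]) is bilinear over functions only for
    sections of H, where testing against a frame suffices. Its defect along r turns the lifting
    condition into an equation for the derivative of f. Since [reeb], [levi_inv] and the
    representatives of cosets are obtained by choice, existence has to be established before
    anything can be computed from them: pairing H with itself gives a square system of size 2n for
    r, pairing E with F one of size n for mu. *)

Section Ck.
Context {R : realType} {d : nat}.
Implicit Types (U V : set 'rV[R]_d) (f g : 'rV[R]_d -> R).

Lemma Ck_sub k U V f : V `<=` U -> Ck k U f -> Ck k V f.
Proof.
move=> VU; elim: k f => [|k IHk] f [cf Df].
  by split=> // x /VU; exact: cf.
split=> [x /VU|i]; first exact: cf.
by have [df Dkf] := Df i; split=> [x Vx|]; [exact: df (VU _ Vx)|exact: IHk].
Qed.

Lemma Ck_pred k U f : Ck k.+1 U f -> Ck k U f.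
Proof.
elim: k f => [|k IHk] f [cf Df]; first by split.
split=> // i; have [df Dkf] := Df i; split=> //; exact: IHk.
Qed.

Lemma continuous_in_eq U f g : open U -> {in U, f =1 g} ->
  (forall x, U x -> {for x, continuous f}) ->
  forall x, U x -> {for x, continuous g}.
Proof.
move=> oU fg cf x Ux; have fgx : f x = g x by apply: fg; rewrite inE.
rewrite /prop_for /continuous_at -fgx; apply: cvg_trans (cf _ Ux).
apply: (@near_eq_cvg _ _ (nbhs x)); near=> y; apply: fg; rewrite inE.
by near: y; exact: open_nbhs_nbhs.
Unshelve. all: by end_near. Qed.

(** Openness makes the two functions agree near each point of [U], so that their partial derivatives
    agree on [U] too and the induction goes on. *)
Lemma Ck_eq k U f g : open U -> {in U, f =1 g} -> Ck k U f -> Ck k U g.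
Proof.
move=> oU; elim: k f g => [|k IHk] f g fg Cf.
  by split=> //; case: Cf => cf _; exact: continuous_in_eq oU fg cf.
case: Cf => cf Df; split=> [|i]; first exact: continuous_in_eq oU fg cf.
have near_fg x : U x -> \forall y \near x, f y = g y.
  by move=> Ux; near=> y; apply: fg; rewrite inE; near: y; exact: open_nbhs_nbhs.
have [df Dkf] := Df i; split=> [x Ux|].
  by apply: near_eq_derivable (df _ Ux); near=> y; near: y; exact: near_fg.
apply: IHk Dkf => x /set_mem Ux /=.
by apply: near_eq_derive; near=> y; near: y; exact: near_fg.
Unshelve. all: by end_near. Qed.

Lemma Ck_cst k U c : Ck k U (fun=> c).
Proof.
elim: k c => [|k IHk] c; first by split=> // x _; exact: cst_continuous.
split=> [x _|i]; first exact: cst_continuous.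
split=> [x _|]; first exact: derivable_cst.
by rewrite (_ : 'D_(delta_mx 0 i) _ = fun=> 0)//; apply/funext => x; exact: derive_cst.
Qed.

Lemma CkD k U f g : open U -> Ck k U f -> Ck k U g -> Ck k U (f + g).
Proof.
move=> oU; elim: k f g => [|k IHk] f g [cf Df] [cg Dg].
  by split=> // x Ux; apply: continuousD; [exact: cf|exact: cg].
split=> [x Ux|i]; first by apply: continuousD; [exact: cf|exact: cg].
have [df Dkf] := Df i; have [dg Dkg] := Dg i.
split=> [x Ux|]; first by apply: derivableD; [exact: df|exact: dg].
apply: Ck_eq (IHk _ _ Dkf Dkg) => // x /set_mem Ux.
by rewrite deriveD//; [exact: df|exact: dg].
Qed.

Lemma CkM k U f g : open U -> Ck k U f -> Ck k U g -> Ck k U (f * g).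
Proof.
move=> oU; elim: k f g => [|k IHk] f g Cf Cg.
  case: Cf Cg => cf Df [cg Dg].
  by split=> // x Ux; apply: continuousM; [exact: cf|exact: cg].
have := Ck_pred Cf; have := Ck_pred Cg.
case: Cf Cg => cf Df [cg Dg] Ckg Ckf.
split=> [x Ux|i]; first by apply: continuousM; [exact: cf|exact: cg].
have [df Dkf] := Df i; have [dg Dkg] := Dg i.
split=> [x Ux|]; first by apply: derivableM; [exact: df|exact: dg].
apply: (Ck_eq _ _ (CkD oU (IHk _ _ Ckf Dkg) (IHk _ _ Ckg Dkf))) => //.
by move=> x /set_mem Ux; rewrite deriveM//; [exact: df|exact: dg].
Qed.

Lemma CkV k U f : open U -> (forall x, U x -> f x != 0) -> Ck k U f ->
  Ck k U (fun x => (f x)^-1).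
Proof.
move=> oU f0; elim: k => [|k IHk] Cf.
  by case: Cf => cf Df; split=> // x Ux; apply: continuousV; [exact: f0|exact: cf].
have Ckf := IHk (Ck_pred Cf); case: Cf => cf Df.
split=> [x Ux|i]; first by apply: continuousV; [exact: f0|exact: cf].
have [df Dkf] := Df i.
split=> [x Ux|]; first by apply: derivableV; [exact: f0|exact: df].
apply: (Ck_eq _ _ (CkM oU (Ck_cst _ _ (-1)) (CkM oU (CkM oU Ckf Ckf) Dkf))) => //.
move=> x /set_mem Ux; rewrite deriveV; [|exact: f0|exact: df].
by rewrite /= !fctE mulN1r -mulNr -expr2 -exprVn.
Qed.

End Ck.

Section smooth_functions.
Context {R : realType} {d : nat} {M : manifold R d}.
Implicit Types (f g : M -> R) (p : M).

(** Combining two smooth functions shrinks the neighbourhood, and the calculus of [Ck] needs the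
    chart image of the smaller one to be open. Points near the image pull back into [U] by
    continuity of the inverse chart. *)
Lemma chart_image_open (a : chart R d M) (U : set M) :
  open U -> open (cmap a @` (U `&` cdom a)).
Proof.
move=> oU; rewrite openE => x [p [Up ap] <-{x}].
have xa : (cmap a @` cdom a) (cmap a p) by exists p.
have ca : cinv a @ cmap a p --> p.
  by have := cinv_continuous xa; rewrite /prop_for /continuous_at cmapK.
near=> y.
have [q aq qy] : (cmap a @` cdom a) y.
  by near: y; apply: open_nbhs_nbhs; split=> //; exact: cimg_open.
exists q => //; split=> //; rewrite -(cmapK aq) qy; near: y.
by apply: ca; exact: open_nbhs_nbhs.
Unshelve. all: by end_near. Qed.

Lemma near_open (P : set M) p : (\forall q \near p, P q) ->
  exists V, [/\ open V, V p & V `<=` P].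
Proof.
move=> nP; have : nbhs p P by exact: nP.
by rewrite nbhsE => -[V [oV Vp] VP]; exists V.
Qed.

Lemma smooth_at_near f p : smooth_at f p -> \forall q \near p, smooth_at f q.
Proof.
move=> [U [oU Up fU]].
have : nbhs p U by exact: open_nbhs_nbhs.
by apply: filterS => q Uq; exists U.
Qed.

Lemma smooth_at_eq f g p : (\forall q \near p, f q = g q) -> smooth_at f p ->
  smooth_at g p.
Proof.
move=> /near_open[V [oV Vp fg]] [U [oU Up fU]].
exists (V `&` U); split=> // [|a aM k]; first exact: openI.
apply: (@Ck_eq _ _ _ _ (f \o cinv a)).
- exact/chart_image_open/openI.
- by move=> _ /set_mem [q [[Vq _] aq] <-] /=; rewrite !cmapK// fg.
- by apply: Ck_sub (fU a aM k) => _ [q [[_ Uq] aq] <-]; exists q.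
Qed.

Lemma smooth_cst c p : smooth_at (fun=> c) p.
Proof. exists setT; split=> // [|a _ k]; [exact: openT|exact: Ck_cst]. Qed.

Let smooth2 (op : (M -> R) -> (M -> R) -> M -> R)
    (op' : ('rV[R]_d -> R) -> ('rV[R]_d -> R) -> 'rV[R]_d -> R) f g p :
  (forall a, op f g \o cinv a = op' (f \o cinv a) (g \o cinv a)) ->
  (forall k U u v, open U -> Ck k U u -> Ck k U v -> Ck k U (op' u v)) ->
  smooth_at f p -> smooth_at g p -> smooth_at (op f g) p.
Proof.
move=> opE Ckop [U [oU Up fU]] [V [oV Vp gV]].
exists (U `&` V); split=> // [|a aM k]; first exact: openI.
rewrite opE; apply: Ckop; first exact/chart_image_open/openI.
- by apply: Ck_sub (fU a aM k) => _ [q [[Uq _] aq] <-]; exists q.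
- by apply: Ck_sub (gV a aM k) => _ [q [[_ Vq] aq] <-]; exists q.
Qed.

Lemma smoothD f g p : smooth_at f p -> smooth_at g p -> smooth_at (f + g) p.
Proof.
by apply: (smooth2 (op := +%R) (op' := +%R)) => // k U ? ?; exact: CkD.
Qed.

Lemma smoothM f g p : smooth_at f p -> smooth_at g p -> smooth_at (f * g) p.
Proof.
by apply: (smooth2 (op := *%R) (op' := *%R)) => // k U ? ?; exact: CkM.
Qed.

Lemma smoothZ c f p : smooth_at f p -> smooth_at (c *: f) p.
Proof. by move=> fp; apply: (smoothM (smooth_cst c p) fp). Qed.

Lemma smoothN f p : smooth_at f p -> smooth_at (- f) p.
Proof. by rewrite -scaleN1r; exact: smoothZ. Qed.

Lemma smoothB f g p : smooth_at f p -> smooth_at g p -> smooth_at (f - g) p.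
Proof. by move=> fp gp; apply: smoothD => //; exact: smoothN. Qed.

Lemma smooth_sum (I : Type) (r : seq I) (P : pred I) (F : I -> M -> R) p :
  (forall i, P i -> smooth_at (F i) p) ->
  smooth_at (fun q => \sum_(i <- r | P i) F i q) p.
Proof.
move=> Fp; rewrite -fct_sumE.
apply: (big_ind (smooth_at^~ p)) => // [|f g]; [exact: smooth_cst|].
exact: smoothD.
Qed.

Lemma smooth_prod (I : Type) (r : seq I) (F : I -> M -> R) p :
  (forall i, smooth_at (F i) p) ->
  smooth_at (fun q => \prod_(i <- r) F i q) p.
Proof.
move=> Fp; elim: r => [|i r IHr].
  by under eq_fun do rewrite big_nil; exact: smooth_cst.
by under eq_fun do rewrite big_cons; exact: smoothM.
Qed.

Lemma smooth_continuous f p : smooth_at f p -> {for p, continuous f}.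
Proof.
move=> [U [oU Up fU]]; have [a aM ap] := atlas_cover p.
have [cf _] := fU a aM 0%N.
have pU : (cmap a @` (U `&` cdom a)) (cmap a p) by exists p.
have := continuous_comp (cmap_continuous ap) (cf _ pU).
rewrite /prop_for /continuous_at /= cmapK//; apply: cvg_trans.
apply: (@near_eq_cvg _ _ (nbhs p)); near=> q => /=; rewrite cmapK//; near: q.
by apply: open_nbhs_nbhs; split=> //; exact: cdom_open.
Unshelve. all: by end_near. Qed.

Lemma smooth_neq0 f p : smooth_at f p -> f p != 0 ->
  \forall q \near p, f q != 0.
Proof.
move=> /smooth_continuous cf fp0.
by apply: (cf [set x | x != 0]); exact: open_nbhs_nbhs (conj (@open_neq _ 0) fp0).
Qed.

Lemma smoothV f p : smooth_at f p -> f p != 0 ->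
  smooth_at (fun q => (f q)^-1) p.
Proof.
move=> fs /(smooth_neq0 fs) /near_open[V [oV Vp f0]].
move: fs => [U [oU Up fU]].
exists (V `&` U); split=> // [|a aM k]; first exact: openI.
apply: CkV.
- exact/chart_image_open/openI.
- by move=> _ [q [[Vq _] aq] <-] /=; rewrite cmapK//; exact: f0.
- by apply: Ck_sub (fU a aM k) => _ [q [[_ Uq] aq] <-]; exists q.
Qed.

Lemma smooth_det k (A : M -> 'M[R]_k) p :
  (forall i j, smooth_at (fun q => A q i j) p) ->
  smooth_at (fun q => \det (A q)) p.
Proof.
move=> As; rewrite /determinant; apply: smooth_sum => s _.
by apply: smoothM; [exact: smooth_cst|exact: smooth_prod].
Qed.

(** Entries of the inverse are cofactors, polynomial in the entries of [A], over a determinant that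
    is nonzero near [p]. As [invmx] returns a singular matrix unchanged, the cofactor formula is
    compared with it only near [p]. *)
Lemma smooth_invmx k (A : M -> 'M[R]_k) p :
  (forall i j, smooth_at (fun q => A q i j) p) -> \det (A p) != 0 ->
  (\forall q \near p, A q \in unitmx) /\
  forall i j, smooth_at (fun q => invmx (A q) i j) p.
Proof.
move=> As dA; have nA : \forall q \near p, A q \in unitmx.
  have := smooth_neq0 (smooth_det As) dA.
  by apply: filterS => q; rewrite unitmxE unitfE.
split=> // i j.
apply: (@smooth_at_eq (fun q => (\det (A q))^-1 * cofactor (A q) j i)).
  by apply: filterS nA => q uA; rewrite /invmx uA !mxE.
apply: smoothM; first by apply: smoothV => //; exact: smooth_det.
apply: smoothM; first exact: smooth_cst.
apply: smooth_det => i' j'.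
by under eq_fun do rewrite !mxE.
Qed.

Lemma smooth_mulmx k l m (A : M -> 'M[R]_(k, l)) (B : M -> 'M[R]_(l, m)) p :
  (forall i j, smooth_at (fun q => A q i j) p) ->
  (forall i j, smooth_at (fun q => B q i j) p) ->
  forall i j, smooth_at (fun q => (A q *m B q) i j) p.
Proof.
move=> As Bs i j; under eq_fun do rewrite mxE.
by apply: smooth_sum => ? _; exact: smoothM.
Qed.

End smooth_functions.

(** * Tangent vectors and brackets *)

Section tangent_vectors.
Context {R : realType} {d : nat} {M : manifold R d}.
Implicit Types (f g : M -> R) (p : M) (u v : (M -> R) -> R).

Lemma tangent_cst p v c : tangent p v -> v (fun=> c) = 0.
Proof.
move=> tv; have s1 : smooth_at (1 : M -> R) p by exact: smooth_cst.
have v1 : v 1 = 0.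
  have := tangent_leibniz tv s1 s1; rewrite mulr1 [X in X * _](_ : _ = 1)// mul1r.
  by move=> /eqP; rewrite -subr_eq0 opprD addrA subrr sub0r oppr_eq0 => /eqP.
have s0 : smooth_at (0 : M -> R) p by exact: smooth_cst.
have v0 : v 0 = 0.
  have := tangent_linear tv (-1) s0 s0; rewrite scaler0 addr0 => ->.
  by rewrite mulN1r addNr.
have := tangent_linear tv c s1 s0; rewrite addr0 v1 v0 mulr0 addr0 => <-.
by congr (v _); apply/funext => q; rewrite /= !fctE /= /GRing.scale /= mulr1.
Qed.

Lemma tangent_add p v f g : tangent p v -> smooth_at f p -> smooth_at g p ->
  v (f + g) = v f + v g.
Proof.
by move=> tv fs gs; have := tangent_linear tv 1 fs gs; rewrite scale1r mul1r.
Qed.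

Lemma tangent_scale p v c f : tangent p v -> smooth_at f p ->
  v (c *: f) = c * v f.
Proof.
move=> tv fs; have := tangent_linear tv c fs (smooth_cst 0 p).
by rewrite (tangent_cst _ tv) -[X in _ + X](_ : 0 = _) // !addr0.
Qed.

Lemma tangent_sub p v f g : tangent p v -> smooth_at f p -> smooth_at g p ->
  v (f - g) = v f - v g.
Proof.
move=> tv fs gs; rewrite -scaleN1r (tangent_add tv)//; last exact: smoothZ.
by rewrite (tangent_scale _ tv)// mulN1r.
Qed.

Lemma tangent_sum p v (I : Type) (r : seq I) (F : I -> M -> R) :
  tangent p v -> (forall i, smooth_at (F i) p) ->
  v (fun q => \sum_(i <- r) F i q) = \sum_(i <- r) v (F i).
Proof.
move=> tv Fs; elim: r => [|i r IHr].
  rewrite big_nil -[RHS](tangent_cst 0 tv).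
  by congr (v _); apply/funext => q; rewrite big_nil.
rewrite big_cons -IHr -(tangent_add tv)//; last exact: smooth_sum.
by congr (v _); apply/funext => q; rewrite big_cons.
Qed.

Lemma lincomb_tangent p c u v : tangent p u -> tangent p v ->
  tangent p (c *: u + v).
Proof.
move=> tu tv; have cuvE f : (c *: u + v) f = c * u f + v f by [].
split=> [f g fs gs fg|a f g fs gs|f g fs gs|f fs]; rewrite !cuvE.
- by rewrite (tangent_germ tu fs gs fg) (tangent_germ tv fs gs fg).
- by rewrite (tangent_linear tu)// (tangent_linear tv)//; ring.
- by rewrite (tangent_leibniz tu)// (tangent_leibniz tv)//; ring.
- by rewrite (tangent_default tu fs) (tangent_default tv fs) mulr0 addr0.
Qed.

Lemma tangent0 p : tangent p 0.
Proof. by split=> // *; rewrite -?[0 _]/(0 : R) ?mulr0 ?addr0. Qed.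

Lemma tangentZ p c v : tangent p v -> tangent p (c *: v).
Proof. by move=> /(lincomb_tangent c) /(_ (tangent0 p)); rewrite addr0. Qed.

Lemma tangentD p u v : tangent p u -> tangent p v -> tangent p (u + v).
Proof. by move=> /(lincomb_tangent 1) h /h; rewrite scale1r. Qed.

Lemma tangentB p u v : tangent p u -> tangent p v -> tangent p (u - v).
Proof. by move=> tu /(lincomb_tangent (-1)) /(_ tu); rewrite scaleN1r addrC. Qed.

Lemma tangent_comb p (I : Type) (r : seq I) (P : pred I) (c : I -> R)
    (v : I -> (M -> R) -> R) : (forall i, P i -> tangent p (v i)) ->
  tangent p (\sum_(i <- r | P i) c i *: v i).
Proof.
move=> tv; apply: (big_ind (tangent p)) => [|x y|i /tv].
- exact: tangent0.
- exact: tangentD.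
- exact: tangentZ.
Qed.

End tangent_vectors.

Section vector_fields.
Context {R : realType} {d : nat} {M : manifold R d}.
Implicit Types (f g : M -> R) (p : M) (X Y Z : vfield R M).

Lemma vf_near X p : smooth_vf_at X p -> \forall q \near p, smooth_vf_at X q.
Proof. exact: near_join. Qed.

Lemma vf_tangent X p : smooth_vf_at X p -> tangent p (X p).
Proof. by move=> /nbhs_singleton[]. Qed.

Lemma vf_app_smooth X f p : smooth_vf_at X p -> smooth_at f p ->
  smooth_at (vf_app X f) p.
Proof. by move=> /nbhs_singleton[_]; exact. Qed.

Lemma vf_eq X Y p : (\forall q \near p, X q = Y q) -> smooth_vf_at X p ->
  smooth_vf_at Y p.
Proof.
move=> XY Xs; near=> q.
have XYq : \forall s \near q, X s = Y s by near: q; exact: near_join.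
have [tX Xf] : tangent q (X q) /\
    forall f, smooth_at f q -> smooth_at (vf_app X f) q by near: q.
split=> [|f fs]; first by rewrite -(nbhs_singleton XYq).
apply: smooth_at_eq (Xf f fs).
by apply: filterS XYq => s; rewrite /vf_app => ->.
Unshelve. all: by end_near. Qed.

Lemma vf_lincomb g X Y p : smooth_at g p -> smooth_vf_at X p ->
  smooth_vf_at Y p -> smooth_vf_at (fun q => g q *: X q + Y q) p.
Proof.
move=> /smooth_at_near gs /vf_near Xs /vf_near Ys; near=> q.
have gq : smooth_at g q by near: q.
have Xq : smooth_vf_at X q by near: q.
have Yq : smooth_vf_at Y q by near: q.
split=> [|f fs]; first by apply: lincomb_tangent; exact: vf_tangent.
apply: smoothD; last exact: vf_app_smooth.
by apply: smoothM => //; exact: vf_app_smooth.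
Unshelve. all: by end_near. Qed.

Lemma vf0 p : smooth_vf_at (0 : vfield R M) p.
Proof.
by near=> q; split=> [|f _]; [exact: tangent0|exact: smooth_cst].
Unshelve. all: by end_near. Qed.

Lemma vfD X Y p : smooth_vf_at X p -> smooth_vf_at Y p ->
  smooth_vf_at (X + Y) p.
Proof.
move=> /(vf_lincomb (smooth_cst 1 p)) h /h; apply: vf_eq.
by near=> q; rewrite scale1r.
Unshelve. all: by end_near. Qed.

Lemma vfZ g X p : smooth_at g p -> smooth_vf_at X p ->
  smooth_vf_at (fun q => g q *: X q) p.
Proof.
move=> gs Xs; apply: vf_eq (vf_lincomb gs Xs (vf0 p)).
by near=> q; rewrite addr0.
Unshelve. all: by end_near. Qed.

Lemma vfB X Y p : smooth_vf_at X p -> smooth_vf_at Y p ->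
  smooth_vf_at (X - Y) p.
Proof.
move=> Xs /(vf_lincomb (smooth_cst (-1) p)) /(_ Xs); apply: vf_eq.
by near=> q; rewrite scaleN1r addrC.
Unshelve. all: by end_near. Qed.

Lemma vf_comb (I : Type) (r : seq I) (c : I -> M -> R) (X : I -> vfield R M) p :
  (forall i, smooth_at (c i) p) -> (forall i, smooth_vf_at (X i) p) ->
  smooth_vf_at (fun q => \sum_(i <- r) c i q *: X i q) p.
Proof.
move=> cs Xs; elim: r => [|i r IHr].
  by apply: vf_eq (vf0 p); near=> q; rewrite big_nil.
apply: vf_eq (vf_lincomb (cs i) (Xs i) IHr).
by near=> q; rewrite big_cons.
Unshelve. all: by end_near. Qed.

Lemma vf_app_linear X c f g p : smooth_vf_at X p -> smooth_at f p ->
  smooth_at g p ->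
  \forall q \near p, vf_app X (c *: f + g) q = (c *: vf_app X f + vf_app X g) q.
Proof.
move=> /vf_near Xs /smooth_at_near fs /smooth_at_near gs; near=> q.
rewrite /vf_app (@tangent_linear _ _ _ q)//; [|by near: q..].
by apply: vf_tangent; near: q.
Unshelve. all: by end_near. Qed.

Lemma vf_app_leibniz X f g p : smooth_vf_at X p -> smooth_at f p ->
  smooth_at g p ->
  \forall q \near p, vf_app X (f * g) q = (f * vf_app X g + g * vf_app X f) q.
Proof.
move=> /vf_near Xs /smooth_at_near fs /smooth_at_near gs; near=> q.
rewrite /vf_app (@tangent_leibniz _ _ _ q)//; [|by near: q..].
by apply: vf_tangent; near: q.
Unshelve. all: by end_near. Qed.

Lemma vbracketE X Y f p : smooth_at f p ->
  vbracket X Y p f = X p (vf_app Y f) - Y p (vf_app X f).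
Proof. by rewrite /vbracket => /asboolP ->. Qed.

Lemma vbracket_default X Y f p : ~ smooth_at f p -> vbracket X Y p f = 0.
Proof. by rewrite /vbracket => /asboolPn/negbTE ->. Qed.

Lemma vbracketC X Y p : vbracket Y X p = - vbracket X Y p.
Proof.
apply/funext => f; rewrite -[RHS]/(- vbracket X Y p f).
have [fs|fs] := pselect (smooth_at f p); last by rewrite !vbracket_default// oppr0.
by rewrite !vbracketE// opprB.
Qed.

(** In the Leibniz rule the mixed products X f * Y g + X g * Y f are symmetric in X and Y and cancel
    in the commutator. *)
Lemma vbracket_tangent X Y p : smooth_vf_at X p -> smooth_vf_at Y p ->
  tangent p (vbracket X Y p).
Proof.
move=> Xs Ys; have [tX tY] := (vf_tangent Xs, vf_tangent Ys).
have Xa f : smooth_at f p -> smooth_at (vf_app X f) p by exact: vf_app_smooth.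
have Ya f : smooth_at f p -> smooth_at (vf_app Y f) p by exact: vf_app_smooth.
split=> [f g fs gs fg|c f g fs gs|f g fs gs|f fs].
- have XY Z : \forall q \near p, smooth_vf_at Z q ->
      vf_app Z f q = vf_app Z g q.
    near=> q => Zq; apply: (tangent_germ (vf_tangent Zq)).
    + by near: q; exact: smooth_at_near.
    + by near: q; exact: smooth_at_near.
    + by near: q; exact: near_join.
  rewrite !vbracketE//; congr (_ - _).
  + apply: (tangent_germ tX); [exact: Ya|exact: Ya|].
    by near=> q; apply: (near (XY Y)) => //; near: q; exact: vf_near.
  + apply: (tangent_germ tY); [exact: Xa|exact: Xa|].
    by near=> q; apply: (near (XY X)) => //; near: q; exact: vf_near.
- have cfg : smooth_at (c *: f + g) p by apply: smoothD => //; exact: smoothZ.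
  have scomb Z : smooth_vf_at Z p -> smooth_at (c *: vf_app Z f + vf_app Z g) p.
    by move=> Zs; apply: smoothD; [apply: smoothZ|]; exact: vf_app_smooth.
  rewrite !vbracketE//.
  rewrite (tangent_germ tX (Ya _ cfg) (scomb Y Ys) (vf_app_linear _ Ys fs gs)).
  rewrite (tangent_germ tY (Xa _ cfg) (scomb X Xs) (vf_app_linear _ Xs fs gs)).
  rewrite !(tangent_linear tX, tangent_linear tY)//; [|by auto..].
  by ring.
- have fg : smooth_at (f * g) p by exact: smoothM.
  have scomb Z : smooth_vf_at Z p -> smooth_at (f * vf_app Z g + g * vf_app Z f) p.
    by move=> Zs; apply: smoothD; apply: smoothM => //; exact: vf_app_smooth.
  rewrite !vbracketE//.
  rewrite (tangent_germ tX (Ya _ fg) (scomb Y Ys) (vf_app_leibniz Ys fs gs)).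
  rewrite (tangent_germ tY (Xa _ fg) (scomb X Xs) (vf_app_leibniz Xs fs gs)).
  rewrite !(tangent_add tX, tangent_add tY); [|by apply: smoothM; auto..].
  rewrite !(tangent_leibniz tX, tangent_leibniz tY)//; [|by auto..].
  rewrite /vf_app; ring.
- exact: vbracket_default.
Unshelve. all: by end_near. Qed.

Lemma vbracket_smooth X Y p : smooth_vf_at X p -> smooth_vf_at Y p ->
  smooth_vf_at (vbracket X Y) p.
Proof.
move=> Xs Ys; near=> q.
have Xq : smooth_vf_at X q by near: q; exact: vf_near.
have Yq : smooth_vf_at Y q by near: q; exact: vf_near.
split=> [|f fs]; first exact: vbracket_tangent.
apply: (@smooth_at_eq _ _ _ (vf_app X (vf_app Y f) - vf_app Y (vf_app X f))).
  near=> s; rewrite /vf_app vbracketE//; near: s; exact: smooth_at_near.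
by apply: smoothB; do 2 apply: vf_app_smooth => //.
Unshelve. all: by end_near. Qed.

Lemma vbracket_eq X X' Y Y' p :
  (\forall q \near p, X q = X' q) -> (\forall q \near p, Y q = Y' q) ->
  smooth_vf_at X p -> smooth_vf_at Y p ->
  vbracket X Y p = vbracket X' Y' p.
Proof.
move=> XX YY Xs Ys; apply/funext => f.
have [fs|fs] := pselect (smooth_at f p); last by rewrite !vbracket_default.
rewrite !vbracketE// -(nbhs_singleton XX) -(nbhs_singleton YY); congr (_ - _).
- apply: (tangent_germ (vf_tangent Xs)); [exact: vf_app_smooth| |].
    by apply: vf_app_smooth => //; exact: vf_eq Ys.
  by apply: filterS YY => q; rewrite /vf_app => ->.
- apply: (tangent_germ (vf_tangent Ys)); [exact: vf_app_smooth| |].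
    by apply: vf_app_smooth => //; exact: vf_eq Xs.
  by apply: filterS XX => q; rewrite /vf_app => ->.
Qed.

(** Sums, differences and function multiples are all instances of this one formula, shaped like the
    linearity clauses of [tangent] and [smooth_form]. *)
Lemma vbracket_lincombl g X Y Z p : smooth_at g p -> smooth_vf_at X p ->
  smooth_vf_at Y p -> smooth_vf_at Z p ->
  vbracket (fun q => g q *: X q + Y q) Z p =
  g p *: vbracket X Z p - Z p g *: X p + vbracket Y Z p.
Proof.
move=> gs Xs Ys Zs; apply/funext => f.
rewrite -[RHS]/(g p * vbracket X Z p f - Z p g * X p f + vbracket Y Z p f).
have [fs|fs] := pselect (smooth_at f p); last first.
  (* On a function that is not smooth at [p] every term vanishes, [X p] included, by the default
     clause of [tangent]. *)
  rewrite !vbracket_default// (tangent_default (vf_tangent Xs))//.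
  by rewrite !mulr0 subrr addr0.
rewrite !vbracketE// -[vf_app (fun q => _ + _) f]/(g * vf_app X f + vf_app Y f).
have tZ := vf_tangent Zs; have aXs := vf_app_smooth Xs fs.
rewrite (tangent_add tZ); [|exact: smoothM|exact: vf_app_smooth].
rewrite (tangent_leibniz tZ)// /vf_app.
rewrite -[(g p *: X p + Y p) _]/(g p * X p (fun q => Z q f) + Y p (fun q => Z q f)).
ring.
Qed.

End vector_fields.

(** * Frames *)

Section frames.
Context {R : realType} {d : nat} {M : manifold R d}.
Implicit Types (p : M) (X : vfield R M) (D : tfamily R M).

Definition independent {k} (v : 'I_k -> (M -> R) -> R) :=
  forall c : 'I_k -> R, \sum_i c i *: v i = 0 -> forall i, c i = 0.

(** Extending a family on ordinals to all naturals lets the induction on [k] keep one index type. *)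
Let nat_family {k} (T : Type) (x0 : T) (v : 'I_k -> T) (i : nat) : T :=
  oapp v x0 (insub i).

Let nat_familyE {k} (T : Type) (x0 : T) (v : 'I_k -> T) (i : 'I_k) :
  nat_family x0 v i = v i.
Proof. by rewrite /nat_family valK. Qed.

(** Induction in the manner of Gram-Schmidt: a function that detects the part of [v k] independent
    of the earlier vectors is corrected to be killed by them, normalised, and then used to correct
    the earlier dual functions. *)
Let dual_functions_nat p (v : nat -> (M -> R) -> R) k :
  (forall i, tangent p (v i)) ->
  (forall c : nat -> R, \sum_(i < k) c i *: v i = 0 ->
    forall i, (i < k)%N -> c i = 0) ->
  exists f : nat -> M -> R, (forall j, smooth_at (f j) p) /\
    forall i j, (i < k)%N -> (j < k)%N -> v i (f j) = (i == j)%:R.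
Proof.
move=> tv; elim: k => [|k IHk] ind.
  by exists (fun=> fun=> 0); split=> // j; exact: smooth_cst.
have [c c0 i ik|f [fs vf]] := IHk.
  have := ind (fun j => if (j < k)%N then c j else 0) _ i (ltnW ik).
  rewrite ik; apply; rewrite big_ord_recr/= ltnn scale0r addr0 -[RHS]c0.
  by apply: eq_bigr => j _; rewrite ltn_ord.
(* [w] is nonzero by independence, hence nonzero on some function [g]. *)
pose w := v k - \sum_(j < k) v k (f j) *: v j.
have tw : tangent p w by apply: tangentB => //; exact: tangent_comb.
have [g wg0] : exists g, w g != 0.
  apply: contrapT => /forallNP wg.
  have w0 : w = 0 by apply/funext => g; apply/eqP/negPn/negP; exact: wg.
  pose c j : R := if j == k then 1 else - v k (f j).
  have /(ind c)/(_ k (leqnn _))/eqP : \sum_(j < k.+1) c j *: v j = 0.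
    rewrite big_ord_recr/= {2}/c eqxx scale1r -[RHS]w0 addrC /w -sumrN.
    by congr (_ + _); apply: eq_bigr => j _; rewrite /c ltn_eqF// scaleNr.
  by rewrite /c eqxx oner_eq0.
(* Tangent vectors vanish on functions that are not smooth at [p], so a nonzero value forces
   smoothness. *)
have gs : smooth_at g p.
  by apply: contrapT => /(tangent_default tw) /eqP; exact/negP.
pose g' : M -> R := g - (fun q => \sum_(j < k) (v j g *: f j) q).
have fjs (j : 'I_k) : smooth_at (v j g *: f j) p by exact: smoothZ.
have g's : smooth_at g' p by apply: smoothB => //; apply: smooth_sum => j _.
have vg' i : v i g' = v i g - \sum_(j < k) v j g * v i (f j).
  rewrite (tangent_sub (tv i))//; last by apply: smooth_sum.
  rewrite (tangent_sum _ (tv i))//; congr (_ - _); apply: eq_bigr => j _.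
  by rewrite (tangent_scale _ (tv i)).
have vg'0 i : (i < k)%N -> v i g' = 0.
  move=> ik; rewrite vg' (bigD1 (Ordinal ik))//= vf// eqxx mulr1 big1 ?addr0 ?subrr//.
  move=> j ji; rewrite vf// [_ == _](_ : _ = false) ?mulr0//.
  by apply: contraNF ji => /eqP ij; apply/eqP/val_inj.
have vkg' : v k g' = w g.
  rewrite vg' -[RHS]/(v k g - (\sum_(j < k) v k (f j) *: v j) g); congr (_ - _).
  by rewrite fct_sumE; apply: eq_bigr => j _; rewrite mulrC.
pose h := (w g)^-1 *: g'.
have hs : smooth_at h p by exact: smoothZ.
have vh0 i : (i < k)%N -> v i h = 0.
  by move=> ik; rewrite (tangent_scale _ (tv i))// vg'0// mulr0.
have vkh : v k h = 1 by rewrite (tangent_scale _ (tv k))// vkg' mulVf.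
(* Subtracting [v k (f j)] times [h] makes [v k] kill the earlier functions; the earlier vectors do
   not notice, since they kill [h]. *)
exists (fun j => if j == k then h else f j - v k (f j) *: h); split=> [j|i j].
  by case: ifP => // _; apply: smoothB => //; exact: smoothZ.
have vfh l : v l (f j - v k (f j) *: h) = v l (f j) - v k (f j) * v l h.
  by rewrite (tangent_sub (tv l))// ?(tangent_scale _ (tv l))//; exact: smoothZ.
have lt_or_eq l : (l < k.+1)%N -> l = k \/ (l < k)%N.
  by rewrite ltnS leq_eqVlt => /predU1P.
move=> /lt_or_eq ik /lt_or_eq[->|jk].
  rewrite eqxx; case: ik => [->|ik]; first by rewrite eqxx vkh.
  by rewrite vh0// ltn_eqF.
rewrite (ltn_eqF jk); case: ik => [->|ik].
  by rewrite vfh vkh mulr1 subrr gtn_eqF.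
by rewrite vfh vh0// mulr0 subr0 vf.
Qed.

Lemma dual_functions p k (v : 'I_k -> (M -> R) -> R) :
  (forall i, tangent p (v i)) -> independent v ->
  exists f : 'I_k -> M -> R, (forall j, smooth_at (f j) p) /\
    forall i j, v i (f j) = (i == j)%:R.
Proof.
move=> tv iv; have [i|c c0 i ik|f [fs vf]] := @dual_functions_nat p (nat_family 0 v) k.
- by rewrite /nat_family; case: insubP => //= _; exact: tangent0.
- apply: (iv (fun j => c j) _ (Ordinal ik)); rewrite -[RHS]c0.
  by apply: eq_bigr => j _; rewrite nat_familyE.
- exists (fun j => f j); split=> // i j; rewrite -[v i](nat_familyE 0).
  exact: vf.
Qed.

(* Testing against functions dual to the family at the point turns the
   coefficients into the solution of a linear system with smooth entries. *)
Lemma coefficients_smooth k (W : 'I_k -> vfield R M) X p :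
  (forall i, smooth_vf_at (W i) p) -> independent (W^~ p) ->
  smooth_vf_at X p ->
  (\forall q \near p, exists c : 'I_k -> R, X q = \sum_i c i *: W i q) ->
  exists a : 'I_k -> M -> R, (forall i, smooth_at (a i) p) /\
    \forall q \near p, X q = \sum_i a i q *: W i q.
Proof.
move=> Ws indW Xs XW.
have [f [fs Wf]] := dual_functions (fun i => vf_tangent (Ws i)) indW.
pose A q : 'M[R]_k := \matrix_(i, j) W i q (f j).
pose b q : 'rV[R]_k := \row_j X q (f j).
have As i j : smooth_at (fun q => A q i j) p.
  by under eq_fun do rewrite mxE; exact: vf_app_smooth.
have bs i j : smooth_at (fun q => b q i j) p.
  by under eq_fun do rewrite mxE; exact: vf_app_smooth.
(* Duality makes the matrix the identity at [p], hence invertible on a neighbourhood. *)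
have A1 : A p = 1%:M by apply/matrixP => i j; rewrite !mxE Wf.
have [|uA As'] := smooth_invmx As; first by rewrite A1 det1 oner_neq0.
exists (fun i q => (b q *m invmx (A q)) 0 i); split=> [i|].
  exact: (smooth_mulmx bs As').
near=> q.
have uAq : A q \in unitmx by near: q.
have [c Xc] : exists c : 'I_k -> R, X q = \sum_i c i *: W i q by near: q.
have bcA : b q = (\row_i c i) *m A q.
  apply/rowP => j; rewrite !mxE Xc fct_sumE.
  by apply: eq_bigr => i _; rewrite !mxE.
by rewrite bcA mulmxK// [LHS]Xc; apply: eq_bigr => i _; rewrite mxE.
Unshelve. all: by end_near. Qed.

(** A frame of [D] alone, without the completion to a frame of TM that [subbundle] carries.
    Independence and spanning are asked near [p], which makes this an open condition on [p]. *)
Definition frame_at D {k} (W : 'I_k -> vfield R M) p :=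
  (forall i, smooth_vf_at (W i) p) /\
  \forall q \near p, independent (W^~ q) /\
    D q = [set v | exists c : 'I_k -> R, v = \sum_i c i *: W i q].

Lemma subbundle_frame k D p : (k <= d)%N -> subbundle k D ->
  exists W : 'I_k -> vfield R M, frame_at D W p.
Proof.
move=> kd /(_ p) [X [Xs XD]]; exists (X \o widen_ord kd); split=> [i|]; first exact: Xs.
near=> q.
have [Xind DX] : (forall v, tangent q v ->
    exists! c : 'rV[R]_d, v = \sum_(i < d) c 0 i *: X i q) /\
    D q = [set v | exists c : 'rV[R]_d,
                     v = \sum_(i < d | (i < k)%N) c 0 i *: X i q] by near: q.
(* Coefficients on the first [k] members are padded by zeros to coordinates in the whole frame of
   TM. *)
pose ext (c : 'I_k -> R) : 'rV[R]_d := \row_(i < d) nat_family 0 c i.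
have extE c : \sum_(i < k) c i *: X (widen_ord kd i) q =
    \sum_(i < d | (i < k)%N) ext c 0 i *: X i q.
  by rewrite (big_ord_narrow kd); apply: eq_bigr => i _; rewrite mxE nat_familyE.
have ext_sum c : \sum_(i < d | (i < k)%N) ext c 0 i *: X i q =
    \sum_(i < d) ext c 0 i *: X i q.
  rewrite [RHS](bigID (fun i : 'I_d => (i < k)%N))/= [X in _ = _ + X]big1 ?addr0//.
  by move=> i ik; rewrite mxE /nat_family insubN// scale0r.
split=> [c c0 i|].
  (* Both zero and the padded [c] are coordinates of the zero vector in the whole frame, where
     coordinates are unique. *)
  have [c' [_ c'u]] := Xind 0 (tangent0 q).
  have e0 : c' = 0.
    by apply: c'u; rewrite big1// => j _; rewrite mxE scale0r.
  have := c'u (ext c); rewrite -ext_sum -extE c0 e0.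
  move=> /(_ erefl)/rowP/(_ (widen_ord kd i)).
  by rewrite !mxE nat_familyE.
rewrite DX; apply/seteqP; split=> _ [c ->] /=.
  by exists (fun i => c 0 (widen_ord kd i)); rewrite (big_ord_narrow kd).
by exists (ext c); rewrite -extE.
Unshelve. all: by end_near. Qed.

Lemma sum_delta (V : lmodType R) k (v : 'I_k -> V) i :
  \sum_j (j == i)%:R *: v j = v i.
Proof.
rewrite (bigD1 i)//= eqxx scale1r big1 ?addr0// => j /negPf ->.
by rewrite scale0r.
Qed.

Section frame_theory.
Context {k : nat} {D : tfamily R M} {W : 'I_k -> vfield R M} {p : M}.
Context (DW : frame_at D W p).

Lemma frame_near : \forall q \near p, frame_at D W q.
Proof.
case: DW => Ws WD; near=> q; split; near: q; last exact: near_join.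
by apply: filter_forall => i; exact: vf_near.
Unshelve. all: by end_near. Qed.

Lemma frame_tangent v : D p v -> tangent p v.
Proof.
case: DW => Ws /nbhs_singleton[_ ->] [c ->].
by apply: tangent_comb => i _; exact: vf_tangent.
Qed.

Lemma frame0 : D p 0.
Proof.
case: DW => Ws /nbhs_singleton[_ ->]; exists (fun=> 0).
by rewrite big1// => i _; rewrite scale0r.
Qed.

Lemma frame_lincomb c u v : D p u -> D p v -> D p (c *: u + v).
Proof.
case: DW => Ws /nbhs_singleton[_ ->] [a ->] [b ->].
exists (fun i => c * a i + b i); rewrite scaler_sumr -big_split/=.
by apply: eq_bigr => i _; rewrite scalerDl scalerA.
Qed.

Lemma frame_dsection i : dsection_at D (W i) p.
Proof.
case: DW => Ws WD; split=> //; apply: filterS WD => q [_ ->].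
by exists (fun j => (j == i)%:R); rewrite sum_delta.
Qed.

Lemma frame_section X : dsection_at D X p ->
  exists a : 'I_k -> M -> R, (forall i, smooth_at (a i) p) /\
    \forall q \near p, X q = \sum_i a i q *: W i q.
Proof.
case: DW => Ws WD [Xs DX]; apply: coefficients_smooth => //.
  by case: (nbhs_singleton WD).
by near=> q; near: q; apply: filterS2 WD DX => q [_ ->].
Unshelve. all: by end_near. Qed.

End frame_theory.

(** * Gluing of locally unique solutions *)

(** The diagonal field takes at each point the value of the solution chosen for that point. By
    uniqueness it agrees near [p] with the one solution chosen for [p], and [Sol] depends only on
    germs; no partition of unity enters. *)
Lemma glue_vector_fields (Sol : vfield R M -> M -> Prop) :
  (forall X Y p, (\forall q \near p, X q = Y q) -> Sol X p -> Sol Y p) ->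
  (forall X Y p, Sol X p -> Sol Y p -> X p = Y p) ->
  (forall p, exists X, \forall q \near p, Sol X q) ->
  exists X, forall p, Sol X p.
Proof.
move=> Sol_eq Sol_uniq /choice[X XSol]; exists (fun p => X p p) => p.
apply: Sol_eq (nbhs_singleton (XSol p)).
apply: filterS (XSol p) => q /Sol_uniq; apply; exact: nbhs_singleton (XSol q).
Qed.

End frames.

(** * Cosets and one-forms *)

Section cosets.
Context {R : realType} {V : lmodType R}.
Implicit Types (A : set V) (u v w : V).

Definition subspace A := A 0 /\ forall (c : R) u v, A u -> A v -> A (c *: u + v).

Lemma subspaceD A u v : subspace A -> A u -> A v -> A (u + v).
Proof. by move=> [_ /(_ 1) sA] /sA /[apply]; rewrite scale1r. Qed.

Lemma subspaceZ A c u : subspace A -> A u -> A (c *: u).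
Proof. by move=> [A0 sA] Au; have := sA c _ _ Au A0; rewrite addr0. Qed.

Lemma subspaceN A u : subspace A -> A u -> A (- u).
Proof. by rewrite -scaleN1r; exact: subspaceZ. Qed.

Lemma subspaceB A u v : subspace A -> A u -> A v -> A (u - v).
Proof. by move=> sA Au Av; apply: subspaceD => //; exact: subspaceN. Qed.

Lemma tcoset_id A v : subspace A -> tcoset A v v.
Proof. by case=> A0 _; rewrite /tcoset/= subrr. Qed.

Lemma tcoset_eqP A u v : subspace A -> tcoset A u = tcoset A v <-> A (u - v).
Proof.
move=> sA; split=> [uv|Auv].
  by have := tcoset_id u sA; rewrite uv.
apply/seteqP; split=> w; rewrite /tcoset/= => Aw.
  by rewrite -(subrKA u); exact: subspaceD.
by rewrite -(subrKA v) -[v - u]opprB; exact: subspaceB.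
Qed.

Lemma tcoset_eq0 A u : subspace A -> tcoset A u = tcoset A 0 <-> A u.
Proof. by move=> sA; have := tcoset_eqP u 0 sA; rewrite subr0. Qed.

Lemma coset_add_tcoset A u v : subspace A ->
  coset_add (tcoset A u) (tcoset A v) = tcoset A (u + v).
Proof.
move=> sA; apply/seteqP; split=> [_ [u' Au] [v' Av] <-|w Aw].
  by rewrite /tcoset/= opprD addrACA; exact: subspaceD.
exists u; first exact: tcoset_id.
by exists (w - u); rewrite ?subrKC// /tcoset/= -addrA -opprD.
Qed.

Lemma coset_scale_tcoset A c v : subspace A ->
  coset_scale A c (tcoset A v) = tcoset A (c *: v).
Proof.
move=> sA; apply/seteqP; split=> [w [u Au Aw]|w Aw]; last first.
  by exists v => //; exact: tcoset_id.
rewrite /tcoset/= -(subrKA (c *: u)) -scalerBr; apply: subspaceD => //.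
exact: subspaceZ.
Qed.

End cosets.

Lemma coset_repr_tcoset {R : realType} {T : Type}
    (A : set ((T -> R) -> R)) v : subspace A -> A (coset_repr (tcoset A v) - v).
Proof.
by move=> /(tcoset_id v) vA; apply: (xgetPex 0 (P := tcoset A v)); exists v.
Qed.

(** * One-forms evaluated on brackets *)

Section forms.
Context {R : realType} {d : nat} {M : manifold R d}.
Context {theta : oneform R M} (ths : smooth_form theta).
Implicit Types (p : M) (X Y Z : vfield R M).

Lemma form0 p : theta p 0 = 0.
Proof.
have := form_linear ths 1 (tangent0 p) (tangent0 p).
rewrite scaler0 addr0 mul1r => /eqP.
by rewrite -subr_eq0 opprD addrA subrr sub0r oppr_eq0 => /eqP.
Qed.

Lemma formZ p c u : tangent p u -> theta p (c *: u) = c * theta p u.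
Proof.
move=> tu; rewrite -[c *: u]addr0 (form_linear ths)// ?form0 ?addr0//.
exact: tangent0.
Qed.

Lemma formD p u v : tangent p u -> tangent p v ->
  theta p (u + v) = theta p u + theta p v.
Proof. by move=> tu tv; rewrite -[u]scale1r (form_linear ths)// scale1r mul1r. Qed.

Lemma formB p u v : tangent p u -> tangent p v ->
  theta p (u - v) = theta p u - theta p v.
Proof.
by move=> tu tv; rewrite -scaleN1r formD ?formZ ?mulN1r//; exact: tangentZ.
Qed.

(** For fields with values in ker theta near [p] this is minus the exterior derivative; for a
    contact form it is there the Levi bracket read in the trivialisation of Q given by theta. *)
Definition bracket_form X Y p := theta p (vbracket X Y p).

Lemma bracket_formC X Y p : smooth_vf_at X p -> smooth_vf_at Y p ->
  bracket_form Y X p = - bracket_form X Y p.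
Proof.
move=> Xs Ys; rewrite /bracket_form vbracketC -scaleN1r formZ ?mulN1r//.
exact: vbracket_tangent.
Qed.

Lemma bracket_formxx X p : bracket_form X X p = 0.
Proof.
rewrite /bracket_form (_ : vbracket X X p = 0) ?form0//; apply/funext => f.
have [fs|fs] := pselect (smooth_at f p); last by rewrite vbracket_default.
by rewrite vbracketE// subrr.
Qed.

Lemma bracket_form_eq X X' Y Y' p :
  (\forall q \near p, X q = X' q) -> (\forall q \near p, Y q = Y' q) ->
  smooth_vf_at X p -> smooth_vf_at Y p ->
  bracket_form X Y p = bracket_form X' Y' p.
Proof. by move=> XX YY Xs Ys; rewrite /bracket_form (vbracket_eq XX YY). Qed.

Lemma bracket_form_smooth X Y p : smooth_vf_at X p -> smooth_vf_at Y p ->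
  smooth_at (bracket_form X Y) p.
Proof. by move=> Xs Ys; apply: (form_smooth ths); exact: vbracket_smooth. Qed.

(** The middle term measures the failure of linearity over functions: it vanishes for X in ker
    theta, and for X the Reeb field it contributes the derivative of the coefficient [g]. *)
Lemma bracket_form_lincombl g X Y Z p : smooth_at g p -> smooth_vf_at X p ->
  smooth_vf_at Y p -> smooth_vf_at Z p ->
  bracket_form (fun q => g q *: X q + Y q) Z p =
  g p * bracket_form X Z p - Z p g * theta p (X p) + bracket_form Y Z p.
Proof.
move=> gs Xs Ys Zs; rewrite /bracket_form vbracket_lincombl//.
have tXZ := vbracket_tangent Xs Zs; have tYZ := vbracket_tangent Ys Zs.
have tX := vf_tangent Xs.
by rewrite formD ?formB ?formZ//; [exact: tangentZ..|apply: tangentB; exact: tangentZ].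
Qed.

Lemma bracket_formDl X Y Z p : smooth_vf_at X p -> smooth_vf_at Y p ->
  smooth_vf_at Z p ->
  bracket_form (X + Y) Z p = bracket_form X Z p + bracket_form Y Z p.
Proof.
move=> Xs Ys Zs; have := bracket_form_lincombl (smooth_cst 1 p) Xs Ys Zs.
rewrite (tangent_cst _ (vf_tangent Zs)) mul0r subr0 mul1r => <-.
congr bracket_form; apply/funext => q; first by rewrite scale1r.
Qed.

Lemma bracket_formBl X Y Z p : smooth_vf_at X p -> smooth_vf_at Y p ->
  smooth_vf_at Z p ->
  bracket_form (X - Y) Z p = bracket_form X Z p - bracket_form Y Z p.
Proof.
move=> Xs Ys Zs; have := bracket_form_lincombl (smooth_cst (-1) p) Ys Xs Zs.
rewrite (tangent_cst _ (vf_tangent Zs)) mul0r subr0 mulN1r addrC => <-.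
by congr bracket_form; apply/funext => q; rewrite scaleN1r addrC.
Qed.

Lemma bracket_form_combl k (a : 'I_k -> M -> R) (W : 'I_k -> vfield R M) Z p :
  (forall i, smooth_at (a i) p) -> (forall i, smooth_vf_at (W i) p) ->
  (forall i, theta p (W i p) = 0) -> smooth_vf_at Z p ->
  bracket_form (fun q => \sum_i a i q *: W i q) Z p =
  \sum_i a i p * bracket_form (W i) Z p.
Proof.
move=> as_ Ws W0 Zs; elim: (index_enum _) => [|i r IHr].
  (* The empty combination is the zero field, treated as Z - Z. *)
  rewrite big_nil -(subrr (bracket_form Z Z p)) -bracket_formBl//.
  congr bracket_form; apply/funext => q.
  by rewrite big_nil -[RHS]/(Z q - Z q) subrr.
rewrite big_cons -IHr.
have -> : (fun q => \sum_(j <- i :: r) a j q *: W j q) =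
          (fun q => a i q *: W i q + \sum_(j <- r) a j q *: W j q).
  by apply/funext => q; rewrite big_cons.
by rewrite bracket_form_lincombl// ?W0 ?mulr0 ?subr0//; exact: vf_comb.
Qed.

Lemma bracket_form_combr k (a : 'I_k -> M -> R) (W : 'I_k -> vfield R M) Z p :
  (forall i, smooth_at (a i) p) -> (forall i, smooth_vf_at (W i) p) ->
  (forall i, theta p (W i p) = 0) -> smooth_vf_at Z p ->
  bracket_form Z (fun q => \sum_i a i q *: W i q) p =
  \sum_i a i p * bracket_form Z (W i) p.
Proof.
move=> as_ Ws W0 Zs; rewrite bracket_formC//; last exact: vf_comb.
rewrite bracket_form_combl// -sumrN; apply: eq_bigr => i _.
by rewrite [in RHS]bracket_formC// mulrN.
Qed.

(** Since the [W i] lie in ker theta, the bracket is linear in the unknown coefficients, with smooth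
    matrix [A]. The last hypothesis says that [A] has trivial row kernel at [p], so it is invertible
    near [p]. *)
Lemma bracket_form_solve k (W V : 'I_k -> vfield R M) (b : 'I_k -> M -> R) p :
  (forall i, smooth_vf_at (W i) p) -> (forall i, smooth_vf_at (V i) p) ->
  (forall i, smooth_at (b i) p) ->
  (forall i, \forall q \near p, theta q (W i q) = 0) ->
  (forall c : 'I_k -> R,
    (forall j, \sum_i c i * bracket_form (W i) (V j) p = 0) ->
    forall i, c i = 0) ->
  exists a : 'I_k -> M -> R, (forall i, smooth_at (a i) p) /\
    \forall q \near p, forall j,
      bracket_form (fun s => \sum_i a i s *: W i s) (V j) q = b j q.
Proof.
move=> Ws Vs bs W0 nondeg.
pose A q : 'M[R]_k := \matrix_(i, j) bracket_form (W i) (V j) q.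
pose B q : 'rV[R]_k := \row_j b j q.
have As i j : smooth_at (fun q => A q i j) p.
  by under eq_fun do rewrite mxE; exact: bracket_form_smooth.
have Bs i j : smooth_at (fun q => B q i j) p.
  by under eq_fun do rewrite mxE; exact: bs.
have uA : A p \in unitmx.
  rewrite -row_free_unit; apply: inj_row_free => v vA0.
  apply/rowP => i; rewrite [RHS]mxE; apply: (nondeg (fun i => v 0 i)) => j.
  move/rowP: vA0 => /(_ j); rewrite !mxE => vA0; rewrite -[RHS]vA0.
  by apply: eq_bigr => l _; rewrite mxE.
have [|uAn As'] := smooth_invmx As; first by rewrite -unitfE -unitmxE.
have as_ := smooth_mulmx Bs As'.
exists (fun i q => (B q *m invmx (A q)) 0 i); split=> //.
near=> q => j; rewrite bracket_form_combl//.
- have uAq : A q \in unitmx by near: q.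
  have /rowP/(_ j) := mulmxKV uAq (B q); rewrite [RHS]mxE => <-.
  by rewrite mxE; apply: eq_bigr => i _; rewrite [A q i j]mxE.
- by near: q; apply: filter_forall => i; exact: smooth_at_near.
- by near: q; apply: filter_forall => i; exact: vf_near.
- by near: q; apply: filter_forall => i; exact: W0.
- by move: j; near: q; apply: filter_forall => j; exact: vf_near.
Unshelve. all: by end_near. Qed.

End forms.
Arguments bracket_form {R d M} theta X Y p.

(** * Legendrean contact structures *)

Section legendrean_contact.
Context {R : realType} {n : nat} {M : manifold R (2 * n).+1}.
Context (L : legendrean M).
Implicit Types (p : M) (X Y Z : vfield R M).

Let rank_le : (n <= (2 * n).+1)%N.
Proof. by rewrite leqW// leq_pmull. Qed.

Lemma LE_frame p : exists W : 'I_n -> vfield R M, frame_at (LE L) W p.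
Proof. exact: subbundle_frame rank_le (LE_subbundle L). Qed.

Lemma LF_frame p : exists W : 'I_n -> vfield R M, frame_at (LF L) W p.
Proof. exact: subbundle_frame rank_le (LF_subbundle L). Qed.

Definition join_frames (V W : 'I_n -> vfield R M) (i : 'I_(n + n)) :=
  match fintype.split i with inl j => V j | inr j => W j end.

Lemma sum_join_frames (V W : 'I_n -> vfield R M) (c : 'I_(n + n) -> R) p :
  \sum_i c i *: join_frames V W i p =
  \sum_i c (lshift n i) *: V i p + \sum_i c (rshift n i) *: W i p.
Proof.
by rewrite big_split_ord; congr (_ + _); apply: eq_bigr => i _;
  rewrite /join_frames ?(unsplitK (inl i)) ?(unsplitK (inr i)).
Qed.

Lemma join_frames_at (V W : 'I_n -> vfield R M) p :
  frame_at (LE L) V p -> frame_at (LF L) W p ->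
  frame_at (LH L) (join_frames V W) p.
Proof.
move=> EV FW; split=> [i|].
  by rewrite /join_frames; case: (fintype.split i) => j; [case: EV|case: FW].
near=> q.
have EVq : frame_at (LE L) V q by near: q; exact: frame_near.
have FWq : frame_at (LF L) W q by near: q; exact: frame_near.
have [_ /nbhs_singleton[Vind EVE]] := EVq.
have [_ /nbhs_singleton[Wind FWE]] := FWq.
split=> [c|].
  rewrite sum_join_frames; set v := \sum_i _; set w := \sum_i _ => vw0.
  have v0 : v = 0.
    have : (LE L q `&` LF L q) v.
      split; first by rewrite EVE; exists (c \o lshift n).
      have -> : v = (-1) *: w + 0.
        by rewrite scaleN1r addr0; apply/eqP; rewrite -addr_eq0 vw0.
      apply: (frame_lincomb FWq); last exact: frame0 FWq.
      by rewrite FWE; exists (c \o @rshift n n).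
    by rewrite L_direct.
  have w0 : w = 0 by move: vw0; rewrite v0 add0r.
  move=> i; rewrite -(splitK i); case: (fintype.split i) => j /=.
    exact: (Vind (c \o lshift n)).
  exact: (Wind (c \o @rshift n n)).
rewrite L_sum; apply/seteqP; split=> [_ [u Eu [w Fw <-]]|_ [c ->]] /=.
  move: Eu Fw; rewrite EVE FWE => -[a ->] [b ->].
  exists (fun i => match fintype.split i with inl j => a j | inr j => b j end).
  rewrite sum_join_frames; congr (_ + _); apply: eq_bigr => i _.
    by rewrite (unsplitK (inl i)).
  by rewrite (unsplitK (inr i)).
rewrite sum_join_frames; exists (\sum_i c (lshift n i) *: V i q).
  by rewrite EVE; exists (c \o lshift n).
exists (\sum_i c (rshift n i) *: W i q) => //.
by rewrite FWE; exists (c \o @rshift n n).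
Unshelve. all: by end_near. Qed.

Lemma LH_frame p : exists W : 'I_(n + n) -> vfield R M, frame_at (LH L) W p.
Proof.
have [V EV] := LE_frame p; have [W FW] := LF_frame p.
by exists (join_frames V W); exact: join_frames_at.
Qed.

Lemma LE_subspace p : subspace (LE L p).
Proof.
have [W EW] := LE_frame p.
by split=> [|c u v]; [exact: frame0 EW|exact: frame_lincomb EW _ _ _].
Qed.

Lemma LF_subspace p : subspace (LF L p).
Proof.
have [W FW] := LF_frame p.
by split=> [|c u v]; [exact: frame0 FW|exact: frame_lincomb FW _ _ _].
Qed.

Lemma LH_subspace p : subspace (LH L p).
Proof.
have [W HW] := LH_frame p.
by split=> [|c u v]; [exact: frame0 HW|exact: frame_lincomb HW _ _ _].
Qed.

Lemma LE_LH p v : LE L p v -> LH L p v.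
Proof.
move=> Ev; rewrite L_sum; exists v => //.
by exists 0; [case: (LF_subspace p)|rewrite addr0].
Qed.

Lemma LF_LH p v : LF L p v -> LH L p v.
Proof.
move=> Fv; rewrite L_sum; exists 0; first by case: (LE_subspace p).
by exists v => //; rewrite add0r.
Qed.

Lemma LH_tangent p v : LH L p v -> tangent p v.
Proof. by have [W HW] := LH_frame p; exact: frame_tangent HW _. Qed.

Lemma LE_LF_eq0 p v : LE L p v -> LF L p v -> v = 0.
Proof. by move=> Ev Fv; have : (LE L p `&` LF L p) v by []; rewrite L_direct. Qed.

Lemma dsection_LE_LH X p : dsection_at (LE L) X p -> dsection_at (LH L) X p.
Proof. by case=> Xs EX; split=> //; apply: filterS EX => q; exact: LE_LH. Qed.

Lemma dsection_LF_LH X p : dsection_at (LF L) X p -> dsection_at (LH L) X p.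
Proof. by case=> Xs FX; split=> //; apply: filterS FX => q; exact: LF_LH. Qed.

Lemma compE_eq p u v : LE L p u -> LF L p (v - u) -> Defs.compE L p v = u.
Proof.
move=> Eu Fvu; have [Ec Fc] : LE L p (Defs.compE L p v) /\ LF L p (v - Defs.compE L p v).
  rewrite /Defs.compE; apply: (xgetPex 0 (P := [set u | LE L p u /\ LF L p (v - u)])).
  by exists u.
apply/eqP; rewrite -subr_eq0; apply/eqP; apply: (@LE_LF_eq0 p).
  exact: subspaceB (LE_subspace p) _ _.
rewrite -(subrKA v) -[_ - v]opprB addrC.
exact: subspaceB (LF_subspace p) _ _.
Qed.

(** The default value 0, taken when [v] has no decomposition, lies in E as well. *)
Lemma compE_LE p v : LE L p (Defs.compE L p v).
Proof.
rewrite /Defs.compE; case: xgetP => [u _ []//|_]; by case: (LE_subspace p).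
Qed.

Lemma compE_decomposition p v : LH L p v -> LF L p (v - Defs.compE L p v).
Proof.
rewrite L_sum => -[u Eu [w Fw <-]].
have uw : LF L p (u + w - u) by rewrite addrAC subrr add0r.
by rewrite (compE_eq Eu uw).
Qed.

(** In a frame of H made of a frame of E followed by one of F, the E-component is the first half of
    the expansion of [X], whose coefficients are smooth. *)
Lemma compE_dsection X p : dsection_at (LH L) X p ->
  dsection_at (LE L) (fun q => Defs.compE L q (X q)) p /\
  dsection_at (LF L) (fun q => X q - Defs.compE L q (X q)) p.
Proof.
move=> HX; have [V EV] := LE_frame p; have [W FW] := LF_frame p.
have [a [as_ Xa]] := frame_section (join_frames_at EV FW) HX.
have compX : \forall q \near p,
    \sum_i a (lshift n i) q *: V i q = Defs.compE L q (X q).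
  near=> q.
  have -> : X q = \sum_i a i q *: join_frames V W i q by near: q.
  rewrite (sum_join_frames V W (a^~ q)); apply/esym/compE_eq.
    have [_ /nbhs_singleton[_ ->]] : frame_at (LE L) V q by near: q; exact: frame_near.
    by exists (fun i => a (lshift n i) q).
  rewrite addrAC subrr add0r.
  have [_ /nbhs_singleton[_ ->]] : frame_at (LF L) W q by near: q; exact: frame_near.
  by exists (fun i => a (rshift n i) q).
have cs : smooth_vf_at (fun q => Defs.compE L q (X q)) p.
  by apply: vf_eq compX _; apply: vf_comb => // i; case: EV.
case: HX => Xs HX; split; split=> //.
- by near=> q; exact: compE_LE.
- exact: vfB.
- by apply: filterS HX => q; exact: compE_decomposition.
Unshelve. all: by end_near. Qed.

(** * Nondegeneracy and isotropy in terms of a contact form *)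

Section contact_form_theory.
Context {theta : oneform R M} (thc : contact_form L theta).
Let ths : smooth_form theta := contact_form_smooth thc.

Lemma form_LH p v : LH L p v -> theta p v = 0.
Proof. by move=> Hv; apply/(contact_form_ker thc) => //; exact: LH_tangent. Qed.

Lemma form_eq0 p v : tangent p v -> theta p v = 0 -> LH L p v.
Proof. by move=> tv /(contact_form_ker thc tv). Qed.

(** A contact form trivialises the line bundle Q, so that equations between classes become scalar
    ones. *)
Lemma tcoset_LHP p u v : tangent p u -> tangent p v ->
  tcoset (LH L p) u = tcoset (LH L p) v <-> theta p u = theta p v.
Proof.
move=> tu tv; split=> [/(tcoset_eqP _ _ (LH_subspace p))/form_LH/eqP|uv].
  by rewrite (formB ths)// subr_eq0 => /eqP.
apply/(tcoset_eqP _ _ (LH_subspace p))/form_eq0; first exact: tangentB.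
by rewrite (formB ths)// uv subrr.
Qed.

Lemma leviP X Y v p : smooth_vf_at X p -> smooth_vf_at Y p -> tangent p v ->
  levi (LH L) X Y p = tcoset (LH L p) v <-> bracket_form theta X Y p = theta p v.
Proof. by move=> Xs Ys tv; apply: tcoset_LHP => //; exact: vbracket_tangent. Qed.

Lemma levi0P X Y p : smooth_vf_at X p -> smooth_vf_at Y p ->
  levi (LH L) X Y p = tcoset (LH L p) 0 <-> bracket_form theta X Y p = 0.
Proof. by move=> Xs Ys; have := leviP Xs Ys (tangent0 p); rewrite (form0 ths). Qed.

Lemma bracket_form_LF_LF X Y p : dsection_at (LF L) X p ->
  dsection_at (LF L) Y p -> bracket_form theta X Y p = 0.
Proof.
move=> FX FY; have [Xs _] := FX; have [Ys _] := FY.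
by apply/levi0P => //; exact: LF_isotropic.
Qed.

Lemma bracket_form_LE_LE X Y p : dsection_at (LE L) X p ->
  dsection_at (LE L) Y p -> bracket_form theta X Y p = 0.
Proof.
move=> EX EY; have [Xs _] := EX; have [Ys _] := EY.
by apply/levi0P => //; exact: LE_isotropic.
Qed.

Lemma LH_nondegenerate X p : dsection_at (LH L) X p ->
  (forall Y, dsection_at (LH L) Y p -> bracket_form theta X Y p = 0) ->
  X p = 0.
Proof.
move=> HX XY; apply: (contact_nondegenerate (LH_contact L) HX) => Y HY.
by have [Xs _] := HX; have [Ys _] := HY; apply/levi0P => //; exact: XY.
Qed.

(** Split a section of H into its components: the E-part pairs to zero with [X] by isotropy of E,
    the F-part by assumption. This is injectivity of E -> F^* (x) Q. *)
Lemma LE_nondegenerate X p : dsection_at (LE L) X p ->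
  (forall Y, dsection_at (LF L) Y p -> bracket_form theta X Y p = 0) ->
  X p = 0.
Proof.
move=> EX XF; apply: LH_nondegenerate => [|Y HY]; first exact: dsection_LE_LH.
have [EY FY] := compE_dsection HY; have [Xs _] := EX; have [Ys _] := HY.
have [EYs _] := EY; have [FYs _] := FY.
rewrite (bracket_formC ths)//.
have := bracket_formDl ths EYs FYs Xs.
rewrite [_ + _](_ : _ = Y); last first.
  by apply/funext => q; rewrite -[LHS]/(_ q + _ q) /= subrKC.
rewrite (bracket_formC ths Xs FYs) (XF _ FY) (bracket_form_LE_LE EY EX).
by rewrite oppr0 addr0 => ->; rewrite oppr0.
Qed.

(** F is its own orthogonal in H for the Levi bracket. The F-part of [X] is orthogonal to F by
    isotropy, so the E-part is too and vanishes; uniqueness of liftings rests on this. *)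
Lemma LF_characterization X p : dsection_at (LH L) X p ->
  (forall Y, dsection_at (LF L) Y p -> bracket_form theta X Y p = 0) ->
  LF L p (X p).
Proof.
move=> HX XF; have [EX FX] := compE_dsection HX.
have [Xs _] := HX; have [EXs _] := EX.
(* The zero in X p - 0 is traded for the E-component of [X], leaving membership of the F-component
   in F. *)
rewrite -[X p](subr0) -(LE_nondegenerate EX) => [|Y FY].
  by case: FX => _ /nbhs_singleton.
have [FXs _] := FX; have [Ys _] := FY.
have := bracket_formBl ths Xs FXs Ys.
rewrite XF// (bracket_form_LF_LF FX FY) subr0 => <-; congr bracket_form.
by apply/funext => q; rewrite -[RHS]/(X q - (X q - _)) subKr.
Qed.

End contact_form_theory.
End legendrean_contact.

(** * The Reeb field and liftings *)

Section reeb_and_lifts.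
Context {R : realType} {n : nat} {M : manifold R (2 * n).+1}.
Context (L : legendrean M).
Implicit Types (p : M) (X Y Z : vfield R M).
Section contact_form_theory.
Context {theta : oneform R M} (thc : contact_form L theta).
Let ths : smooth_form theta := contact_form_smooth thc.

(** * Linear systems given by the Levi bracket *)

(** Conditions on all sections [Y] of [D] reduce to the finitely many members of a frame; the
    coefficients [y] serve every [X] at once. *)
Lemma frame_bracket_form k (D : tfamily R M) (V : 'I_k -> vfield R M) Y p :
  (forall q v, D q v -> LH L q v) -> frame_at D V p -> dsection_at D Y p ->
  exists y : 'I_k -> R, Y p = \sum_i y i *: V i p /\
    forall X, smooth_vf_at X p ->
      bracket_form theta X Y p = \sum_i y i * bracket_form theta X (V i) p.
Proof.
move=> DH DV DY; have [y [ys Yy]] := frame_section DV DY.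
exists (y^~ p); split=> [|X Xs]; first exact: nbhs_singleton Yy.
have [Vs _] := DV; have [Ys _] := DY.
rewrite -(bracket_form_combr ths)//; last first.
  move=> i; apply: (form_LH thc); apply: DH.
  by have [_ /nbhs_singleton] := frame_dsection DV i.
by apply: bracket_form_eq => //; near=> q.
Unshelve. all: by end_near. Qed.

(** Nondegeneracy between two subfamilies of H becomes invertibility of a matrix. The pair (H, H)
    will give the Reeb field, the pair (E, F) the inverse of the Levi isomorphism. *)
Lemma frame_bracket_form_solve k (D D' : tfamily R M)
    (W V : 'I_k -> vfield R M) (b : 'I_k -> M -> R) p :
  (forall q v, D q v -> LH L q v) -> (forall q v, D' q v -> LH L q v) ->
  frame_at D W p -> frame_at D' V p -> (forall i, smooth_at (b i) p) ->
  (forall X, dsection_at D X p ->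
    (forall Y, dsection_at D' Y p -> bracket_form theta X Y p = 0) ->
    X p = 0) ->
  exists X, dsection_at D X p /\
    \forall q \near p, forall j, bracket_form theta X (V j) q = b j q.
Proof.
move=> DH D'H DW D'V bs nondeg; have [Ws WD] := DW; have [Vs VD] := D'V.
have comb_D (a : 'I_k -> M -> R) : (forall i, smooth_at (a i) p) ->
    dsection_at D (fun q => \sum_i a i q *: W i q) p.
  move=> as_; split; first exact: vf_comb.
  by apply: filterS WD => q [_ ->]; exists (a^~ q).
have W0 i q : D q (W i q) -> theta q (W i q) = 0.
  by move=> /DH; exact: form_LH.
have [||a [as_ aV]] := bracket_form_solve ths Ws Vs bs.
- move=> i; have [_] := frame_dsection DW i.
  by apply: filterS => q; exact: W0.
(* A row of the kernel gives the section of [D] with constant coefficients [c]; it pairs to zero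
   with [D'], so it vanishes at [p], and independence of the frame gives [c] = 0. *)
- move=> c c0; have [Wind _] := nbhs_singleton WD; apply: Wind.
  have cs i : smooth_at (fun=> c i) p by exact: smooth_cst.
  apply: (nondeg _ (comb_D _ cs)) => Y D'Y.
  have [y [_ yE]] := frame_bracket_form D'H D'V D'Y.
  rewrite yE; last exact: vf_comb.
  rewrite big1// => j _; rewrite (bracket_form_combl ths)// ?c0 ?mulr0// => i.
  by apply: W0; have [_ /nbhs_singleton] := frame_dsection DW i.
- by exists (fun q => \sum_i a i q *: W i q); split=> //; exact: comb_D.
Qed.

Lemma transversal_field p : exists X, smooth_vf_at X p /\
  \forall q \near p, theta q (X q) = 1.
Proof.
have [X [Xs XH]] := contact_corank1 (LH_contact L) p.
have [Xind HE] := nbhs_singleton XH.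
have Xm0 : theta p (X ord_max p) != 0.
  apply/eqP => /(form_eq0 thc (vf_tangent (Xs ord_max))); rewrite HE => -[c Xc].
  (* If the last member of the frame of TM lay in H, it would have two coordinate vectors: the last
     basis vector and one supported on the indices below 2n. *)
  have [c' [_ c'u]] := Xind _ (vf_tangent (Xs ord_max)).
  have d1 : c' = delta_mx 0 ord_max.
    apply: c'u; rewrite -[LHS](sum_delta (X^~ p)); apply: eq_bigr => i _.
    by rewrite mxE eqxx.
  have c1 : c' = \row_i (if (i < 2 * n)%N then c 0 i else 0).
    apply: c'u; rewrite Xc big_mkcond; apply: eq_bigr => i _; rewrite mxE.
    by case: ifP => // _; rewrite scale0r.
  move: c1; rewrite d1 => /rowP/(_ ord_max); rewrite !mxE !eqxx ltnn => /eqP.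
  by rewrite oner_eq0.
have ts := form_smooth ths (Xs ord_max).
exists (fun q => (theta q (X ord_max q))^-1 *: X ord_max q); split.
  by apply: vfZ => //; exact: smoothV ts Xm0.
near=> q.
rewrite (formZ ths); last by apply: vf_tangent; near: q; exact: vf_near.
by rewrite mulVf//; near: q; exact: smooth_neq0 ts Xm0.
Unshelve. all: by end_near. Qed.

(** * The Reeb field *)

(** A condition on germs, suited to gluing, that tests [r] against H only. The remaining direction
    is that of [r] itself, where the bracket form vanishes by antisymmetry. *)
Let reeb_at (r : vfield R M) p := [/\ smooth_vf_at r p,
  \forall q \near p, theta q (r q) = 1 &
  forall Y, dsection_at (LH L) Y p -> bracket_form theta r Y p = 0].

Let reeb_at_eq r r' p : (\forall q \near p, r q = r' q) -> reeb_at r p ->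
  reeb_at r' p.
Proof.
move=> rr [rs r1 rY]; split.
- exact: vf_eq rs.
- by apply: filterS2 rr r1 => q ->.
- move=> Y HY; rewrite -(rY Y HY); apply/esym/bracket_form_eq => //.
    by near=> q.
  by case: HY.
Unshelve. all: by end_near. Qed.

Let reeb_at_unique r r' p : reeb_at r p -> reeb_at r' p -> r p = r' p.
Proof.
move=> [rs r1 rY] [r's r'1 r'Y]; apply/eqP; rewrite -subr_eq0; apply/eqP.
apply: (LH_nondegenerate thc (X := r - r')) => [|Y HY].
  split; first exact: vfB.
  near=> q.
  have tr : tangent q (r q) by apply: vf_tangent; near: q; exact: vf_near.
  have tr' : tangent q (r' q) by apply: vf_tangent; near: q; exact: vf_near.
  apply: (form_eq0 thc); first exact: tangentB.
  rewrite (formB ths)// (_ : theta q (r q) = 1); last by near: q.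
  by rewrite (_ : theta q (r' q) = 1) ?subrr//; near: q.
by rewrite (bracket_formBl ths)// ?rY ?r'Y ?subrr//; case: HY.
Unshelve. all: by end_near. Qed.

Let reeb_at_local p : exists r, \forall q \near p, reeb_at r q.
Proof.
have [Z [Zs Z1]] := transversal_field p; have [W HW] := LH_frame L p.
have [Ws _] := HW.
have bs i : smooth_at (- bracket_form theta Z (W i)) p.
  by apply: smoothN; exact: (bracket_form_smooth ths).
(* The transversal [Z] is corrected within H: [X] cancels the pairing of [Z] with a frame of H and
   leaves the value of theta unchanged. *)
have [X [HX XW]] := frame_bracket_form_solve (fun _ _ => id) (fun _ _ => id)
  HW HW bs (@LH_nondegenerate _ _ _ L _ thc ^~ p).
have [Xs /near_join HXn] := HX.
exists (Z + X); near=> q.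
have Zq : smooth_vf_at Z q by near: q; exact: vf_near.
have Xq : smooth_vf_at X q by near: q; exact: vf_near.
have HXq : \forall s \near q, LH L s (X s) by near: q.
have Z1q : \forall s \near q, theta s (Z s) = 1 by near: q; exact: near_join.
have HWq : frame_at (LH L) W q by near: q; exact: frame_near.
have XWq : forall j, bracket_form theta X (W j) q = - bracket_form theta Z (W j) q.
  by near: q.
split; first exact: vfD.
  near=> s.
  have HXs : LH L s (X s) by near: s.
  have tZs : tangent s (Z s) by apply: vf_tangent; near: s; exact: vf_near.
  rewrite (formD ths tZs); last exact: LH_tangent HXs.
  by rewrite (form_LH thc HXs) addr0; near: s.
move=> Y HY; have [y [_ yE]] := frame_bracket_form (fun _ _ => id) HWq HY.
have [Ys _] := HY; rewrite (bracket_formDl ths)// !yE// -big_split big1// => i _.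
by rewrite /= XWq mulrN subrr.
Unshelve. all: by end_near. Qed.

(** Write Y = g r + Y' with g = theta(Y) and Y' in H. Then theta([r, Y']) = 0 and theta([r, g r]) =
    r g, which cancels the term r(theta(Y)) of the exterior derivative. *)
Lemma reeb_is_reeb : is_reeb theta (reeb theta).
Proof.
have [r rr] := glue_vector_fields reeb_at_eq reeb_at_unique reeb_at_local.
apply: (xgetPex 0 (P := [set r | is_reeb theta r])); exists r.
have r1 p : theta p (r p) = 1 by have [_ /nbhs_singleton] := rr p.
split=> // p; first by case: (rr p).
move=> Y Ys; have [rs _ rH] := rr p.
have gs := form_smooth ths Ys; set g := form_app theta Y in gs *.
pose Y' := Y - (fun q => g q *: r q).
have grs := vfZ gs rs; have Y's : smooth_vf_at Y' p by exact: vfB.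
have HY' : dsection_at (LH L) Y' p.
  split=> //; near=> q.
  have tY : tangent q (Y q) by apply: vf_tangent; near: q; exact: vf_near.
  have tr : tangent q (r q) by apply: vf_tangent; near: q; exact: vf_near.
  rewrite -[Y' q]/(Y q - g q *: r q).
  apply: (form_eq0 thc); first by apply: tangentB => //; exact: tangentZ.
  by rewrite (formB ths)// ?(formZ ths)// ?r1 ?mulr1 ?subrr//; exact: tangentZ.
rewrite /dform (_ : form_app theta r = fun=> 1); last first.
  by apply/funext => q; exact: r1.
rewrite (tangent_cst _ (vf_tangent Ys)) subr0 -/(bracket_form theta r Y p).
have YE : bracket_form theta Y r p =
    bracket_form theta (fun q => g q *: r q + Y' q) r p.
  apply: bracket_form_eq => //; near=> q => //.
  by rewrite -[Y' q]/(Y q - g q *: r q) subrKC.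
rewrite (bracket_formC ths Ys rs) YE (bracket_form_lincombl ths)//.
rewrite (bracket_formC ths rs Y's) (rH _ HY') (bracket_formxx ths) r1.
by rewrite mulr0 sub0r mulr1 oppr0 addr0 opprK subrr.
Unshelve. all: by end_near. Qed.

Let r := reeb theta.

Lemma reeb_smooth p : smooth_vf_at r p.
Proof. by case: reeb_is_reeb. Qed.

Lemma reeb_tangent p : tangent p (r p).
Proof. exact: vf_tangent (reeb_smooth p). Qed.

Lemma form_reeb p : theta p (r p) = 1.
Proof. by case: reeb_is_reeb. Qed.

Lemma bracket_form_reeb Y p : dsection_at (LH L) Y p ->
  bracket_form theta r Y p = 0.
Proof.
move=> [Ys HY]; have [_ _ /(_ p Y Ys)] := reeb_is_reeb.
rewrite /dform -/r (_ : form_app theta r = fun=> 1); last first.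
  by apply/funext => q; exact: form_reeb.
rewrite (tangent_cst _ (vf_tangent Ys)) subr0.
rewrite (tangent_germ (reeb_tangent p) (form_smooth ths Ys) (smooth_cst 0 p)).
  by rewrite (tangent_cst _ (reeb_tangent p)) sub0r => /eqP; rewrite oppr_eq0 => /eqP.
by apply: filterS HY => q; exact: form_LH.
Qed.

(** * The section of E that represents a derivative along F *)

(** For f = theta(rho) this is the scalar form of the equation defining nabla^Q rho as a section of
    E. *)
Let gradient_at (f : M -> R) X p := dsection_at (LE L) X p /\
  forall Y, dsection_at (LF L) Y p -> bracket_form theta X Y p = Y p f.

Let gradient_at_eq f X X' p : (\forall q \near p, X q = X' q) ->
  gradient_at f X p -> gradient_at f X' p.
Proof.
move=> XX [[Xs EX] XY]; split=> [|Y FY].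
  by split; [exact: vf_eq Xs|apply: filterS2 XX EX => q ->].
have [Ys _] := FY; rewrite -XY//; apply/esym/bracket_form_eq => //.
by near=> q.
Unshelve. all: by end_near. Qed.

Let gradient_at_unique f X X' p : gradient_at f X p -> gradient_at f X' p ->
  X p = X' p.
Proof.
move=> [[Xs EX] XY] [[X's EX'] X'Y]; apply/eqP; rewrite -subr_eq0; apply/eqP.
apply: (LE_nondegenerate thc (X := X - X')) => [|Y FY].
  split; first exact: vfB.
  by apply: filterS2 EX EX' => q; apply: subspaceB; exact: LE_subspace.
by have [Ys _] := FY; rewrite (bracket_formBl ths)// XY// X'Y// subrr.
Qed.

Let gradient_at_local f p : (forall q, smooth_at f q) ->
  exists X, \forall q \near p, gradient_at f X q.
Proof.
move=> fs; have [W EW] := LE_frame L p; have [V FV] := LF_frame L p.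
have [Vs _] := FV.
have bs i : smooth_at (vf_app (V i) f) p by exact: vf_app_smooth.
have [X [[Xs EX] XV]] := frame_bracket_form_solve (@LE_LH _ _ _ L)
  (@LF_LH _ _ _ L) EW FV bs (@LE_nondegenerate _ _ _ L _ thc ^~ p).
exists X; near=> q.
have Xq : smooth_vf_at X q by near: q; exact: vf_near.
have EXq : \forall s \near q, LE L s (X s) by near: q; exact: near_join.
have FVq : frame_at (LF L) V q by near: q; exact: frame_near.
have XVq : forall j, bracket_form theta X (V j) q = V j q f by near: q.
split=> // Y FY.
have [y [yE bE]] := frame_bracket_form (@LF_LH _ _ _ L) FVq FY.
rewrite bE// yE fct_sumE; apply: eq_bigr => i _.
by rewrite XVq.
Unshelve. all: by end_near. Qed.

(** One solution proves that the chosen one is a solution as well; nondegeneracy between E and F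
    then makes the two equal. *)
Lemma levi_inv_eq (Phi : vfield R M -> tfamily R M) X :
  (forall p, dsection_at (LE L) X p) ->
  (forall p Y, dsection_at (LF L) Y p -> levi (LH L) X Y p = Phi Y p) ->
  levi_inv L Phi = X.
Proof.
move=> EX XPhi; have Xsol : dsection (LE L) X.
  by move=> p; have [Xs /nbhs_singleton] := EX p.
pose P := [set X | dsection (LE L) X /\
  forall p Y, dsection_at (LF L) Y p -> levi (LH L) X Y p = Phi Y p].
have [EX' X'Phi] : P (levi_inv L Phi) by apply: (xgetPex 0 (P := P)); exists X.
set X' := levi_inv L Phi in EX' X'Phi *.
apply/funext => p; apply/eqP; rewrite -subr_eq0; apply/eqP.
have [Xs _] := EX p; have [X's _] := EX' p.
apply: (LE_nondegenerate thc (X := X' - X)) => [|Y FY].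
  split; first exact: vfB.
  near=> q; apply: (subspaceB (LE_subspace L q)); [exact: (EX' q).2|exact: (Xsol q).2].
have [Ys _] := FY; rewrite (bracket_formBl ths)//.
apply/eqP; rewrite subr_eq0; apply/eqP.
have tXY := vbracket_tangent Xs Ys.
by apply/(leviP thc X's Ys tXY); rewrite X'Phi// -XPhi.
Unshelve. all: by end_near. Qed.

Lemma nablaQ_levi_inv rho (mu := levi_inv L (nablaQ L theta rho)) p :
  (forall q, smooth_at (form_Q theta rho) q) ->
  dsection_at (LE L) mu p /\
  forall Y, dsection_at (LF L) Y p ->
    bracket_form theta mu Y p = Y p (form_Q theta rho).
Proof.
move=> fs; have [X Xg] := glue_vector_fields (@gradient_at_eq (form_Q theta rho))
  (@gradient_at_unique (form_Q theta rho)) (fun p => gradient_at_local p fs).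
rewrite (_ : mu = X); first exact: Xg.
apply: levi_inv_eq => [q|q Y FY]; first by have [] := Xg q.
have [EX XY] := Xg q; have [Xs _] := EX; have [Ys _] := FY.
apply/(leviP thc Xs Ys); first exact/tangentZ/reeb_tangent.
by rewrite XY// (formZ ths) ?form_reeb ?mulr1//; exact: reeb_tangent.
Qed.

(** * The splitting of TM/F *)

Lemma LH_vector_split p v : tangent p v -> LH L p (v - theta p v *: r p).
Proof.
move=> tv; have tr := reeb_tangent p; apply: (form_eq0 thc).
  by apply: tangentB => //; exact: tangentZ.
rewrite (formB ths)//; last exact: tangentZ.
by rewrite (formZ ths)// form_reeb mulr1 subrr.
Qed.

(** The splitting depends only on the class modulo F, so the representative picked by [coset_repr]
    can be replaced by any other. *)
Lemma split_vec_LF p u v : tangent p v -> LF L p (u - v) ->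
  split_vec L theta p u = split_vec L theta p v.
Proof.
move=> tv Fuv; have tuv := LH_tangent (LF_LH Fuv).
have uE : u = v + (u - v) by rewrite subrKC.
have thuv : theta p u = theta p v.
  by rewrite uE (formD ths)// (form_LH thc (LF_LH Fuv)) addr0.
congr pair; first by apply/(tcoset_eqP _ _ (LH_subspace L p)); exact: LF_LH.
apply: compE_eq; first exact: compE_LE.
rewrite -/r thuv; set w := v - theta p v *: r p.
have -> : u - theta p v *: r p - Defs.compE L p w =
    (u - v) + (w - Defs.compE L p w) by rewrite /w !addrA subrK.
apply: subspaceD => //; first exact: LF_subspace.
exact/compE_decomposition/LH_vector_split.
Qed.

Lemma split_vecK p v : tangent p v ->
  LF L p (v - (theta p v *: r p + (split_vec L theta p v).2)).
Proof.
move=> tv; rewrite opprD addrA.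
exact/compE_decomposition/LH_vector_split.
Qed.

Lemma split_vec_reeb p a u : LE L p u ->
  split_vec L theta p (a *: r p + u) = (tcoset (LH L p) (a *: r p), u).
Proof.
move=> Eu; have tr := reeb_tangent p; have tu := LH_tangent (LE_LH Eu).
have thv : theta p (a *: r p + u) = a.
  rewrite (formD ths)//; last exact: tangentZ.
  by rewrite (formZ ths)// form_reeb mulr1 (form_LH thc (LE_LH Eu)) addr0.
congr pair.
  apply/(tcoset_eqP _ _ (LH_subspace L p)).
  by rewrite addrAC subrr add0r; exact: LE_LH.
rewrite -/r thv addrAC subrr add0r; apply: compE_eq => //.
by rewrite subrr; case: (LF_subspace L p).
Qed.

Lemma qsection_LF_repr t p : qsection (LF L) t ->
  tangent p (coset_repr (t p)) /\ t p = tcoset (LF L p) (coset_repr (t p)).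
Proof.
move=> /(_ p)[X /vf_tangent tX /nbhs_singleton ->].
have FX := coset_repr_tcoset (X p) (LF_subspace L p).
set u := coset_repr _ in FX *; split.
  by rewrite -(subrK (X p) u); apply: tangentD => //; exact: LH_tangent (LF_LH FX).
apply/(tcoset_eqP _ _ (LF_subspace L p)).
by rewrite -opprB; exact: subspaceN (LF_subspace L p) _.
Qed.

Lemma form_Q_tcoset rho p v : tangent p v -> rho p = tcoset (LH L p) v ->
  form_Q theta rho p = theta p v.
Proof.
move=> tv rhoE; have Hv := coset_repr_tcoset v (LH_subspace L p).
rewrite /form_Q rhoE -[coset_repr _](subrK v) (formD ths)//.
  by rewrite (form_LH thc Hv) add0r.
exact: LH_tangent Hv.
Qed.

Lemma form_Q_smooth rho p : qsection (LH L) rho ->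
  smooth_at (form_Q theta rho) p.
Proof.
move=> /(_ p)[X Xs rhoX]; apply: smooth_at_eq (form_smooth ths Xs).
near=> q; apply/esym/form_Q_tcoset; last by near: q.
by apply: vf_tangent; near: q; exact: vf_near.
Unshelve. all: by end_near. Qed.

(** The chosen representatives of [t] need not vary smoothly. Near [p] the splitting is computed
    instead from a smooth field [X] representing [t]. *)
Lemma split_TF_dsection t p : qsection (LF L) t ->
  dsection_at (LE L) (fun q => (split_TF L theta t q).2) p.
Proof.
move=> Ft; have [X Xs tX] := Ft p.
have HX : dsection_at (LH L) (fun q => X q - theta q (X q) *: r q) p.
  split.
    by apply: vfB => //; apply: vfZ (form_smooth ths Xs) (reeb_smooth p).
  by apply: filterS (vf_near Xs) => q /vf_tangent /LH_vector_split.
have [[cs _] _] := compE_dsection HX.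
split; last by near=> q; exact: compE_LE.
apply: vf_eq cs; near=> q; rewrite /split_TF.
have tq : t q = tcoset (LF L q) (X q) by near: q.
have Xq : tangent q (X q) by apply: vf_tangent; near: q; exact: vf_near.
rewrite (split_vec_LF Xq)// tq.
exact: coset_repr_tcoset (LF_subspace L q).
Unshelve. all: by end_near. Qed.

(* This condition mentions no contact form, whence the independence of the
   operator from the contact form used to define the connection. *)
Definition lifting (rho t : tfamily R M) :=
  forall p, exists X, \forall q \near p,
    [/\ smooth_vf_at X q, t q = tcoset (LF L q) (X q),
        rho q = tcoset (LH L q) (X q) &
        forall Y, dsection_at (LF L) Y q -> LH L q (vbracket X Y q)].

(** Two local representatives differ by a section of H, as both project to [rho], and this section
    is orthogonal to F, hence in F at [p]. *)
Lemma lifting_unique rho t t' : lifting rho t -> lifting rho t' -> t = t'.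
Proof.
move=> tl t'l; apply/funext => p; have [X Xl] := tl p; have [X' X'l] := t'l p.
have [Xs tX _ XY] := nbhs_singleton Xl; have [X's t'X' _ X'Y] := nbhs_singleton X'l.
rewrite tX t'X'; apply/(tcoset_eqP _ _ (LF_subspace L p)).
apply: (LF_characterization thc (X := X - X')) => [|Y FY].
  split; first exact: vfB.
  apply: filterS2 Xl X'l => q [_ _ -> _] [_ _ XX' _].
  exact/(tcoset_eqP _ _ (LH_subspace L q)).
have [Ys _] := FY; rewrite (bracket_formBl ths)// /bracket_form.
by rewrite (form_LH thc (XY Y FY)) (form_LH thc (X'Y Y FY)) subrr.
Qed.

Definition canonical_lift (rho : tfamily R M) : tfamily R M := fun p =>
  tcoset (LF L p)
    (form_Q theta rho p *: r p + levi_inv L (nablaQ L theta rho) p).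

Lemma canonical_lift_lifting rho : qsection (LH L) rho ->
  lifting rho (canonical_lift rho).
Proof.
move=> Hrho p; have fs q := form_Q_smooth q Hrho.
set f := form_Q theta rho in fs *.
set mu := levi_inv L (nablaQ L theta rho).
exists (fun q => f q *: r q + mu q); near=> q.
have [Emu muF] := nablaQ_levi_inv q fs; rewrite -/mu in Emu muF.
have [mus /nbhs_singleton Eq] := Emu; have rs := reeb_smooth q.
have tr := reeb_tangent q; have tmu := LH_tangent (LE_LH Eq).
have Xs := vf_lincomb (fs q) rs mus.
split=> //.
  have [X /vf_tangent tX /nbhs_singleton rhoX] := Hrho q.
  rewrite rhoX; apply/(tcoset_LHP thc tX (vf_tangent Xs)).
  rewrite (formD ths)//; last exact: tangentZ.
  rewrite (formZ ths)// form_reeb mulr1 (form_LH thc (LE_LH Eq)) addr0.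
  exact/esym/form_Q_tcoset.
move=> Y FY; have [Ys _] := FY.
apply: (form_eq0 thc); first exact: vbracket_tangent.
(* Differentiating the coefficient of r gives - Y f, and theta([mu, Y]) = Y f compensates it. *)
rewrite -/(bracket_form theta _ Y q) (bracket_form_lincombl ths)// muF// -/f.
rewrite form_reeb mulr1 (bracket_form_reeb (dsection_LF_LH FY)).
by rewrite mulr0 sub0r addNr.
Unshelve. all: by end_near. Qed.

Lemma lifting_qsection rho t : lifting rho t -> qsection (LF L) t.
Proof.
move=> tl p; have [X Xl] := tl p; exists X.
  by have [] := nbhs_singleton Xl.
by apply: filterS Xl => q [].
Qed.

Lemma lifting_piQ rho t : lifting rho t -> piQ L t = rho.
Proof.
move=> tl; apply/funext => p; have [X /nbhs_singleton[_ tX -> _]] := tl p.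
rewrite /piQ tX; apply/(tcoset_eqP _ _ (LH_subspace L p))/LF_LH.
exact: coset_repr_tcoset (LF_subspace L p).
Qed.

Lemma split_canonical_lift rho p : qsection (LH L) rho ->
  split_TF L theta (canonical_lift rho) p =
  (rho p, levi_inv L (nablaQ L theta rho) p).
Proof.
move=> Hrho; have fs q := form_Q_smooth q Hrho.
have [[_ /nbhs_singleton Emu] _] := nablaQ_levi_inv p fs.
set mu := levi_inv _ _ in Emu *.
rewrite [LHS]surjective_pairing; congr pair.
  by rewrite -[in RHS](lifting_piQ (canonical_lift_lifting Hrho)).
rewrite /split_TF (@split_vec_LF p _ (form_Q theta rho p *: r p + mu p)).
- by rewrite split_vec_reeb.
- by apply: tangentD; [exact/tangentZ/reeb_tangent|exact: LH_tangent (LE_LH Emu)].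
- exact: coset_repr_tcoset (LF_subspace L p).
Qed.

(** * The equation for the lift *)

(** After projection to Q only nabla^Q rho + L(xi, mu) is left of the connection. By antisymmetry
    L(xi, mu) = - L(mu, xi), so the Levi isomorphism turns the sum into nabla^Q rho - mu. *)
Lemma dstar_nablaTF t p (rho := piQ L t) : qsection (LH L) rho ->
  qsection (LF L) t ->
  dstar L (nablaTF L theta t) p =
  tcoset (LF L p)
    (levi_inv L (nablaQ L theta rho) p - (split_TF L theta t p).2).
Proof.
move=> Hrho Ft; have fs q := form_Q_smooth q Hrho.
set nu := levi_inv L (nablaQ L theta rho).
pose mu q := (split_TF L theta t q).2.
rewrite /dstar (_ : levi_inv L _ = nu - mu)//.
have nuE q := nablaQ_levi_inv q fs; rewrite -/nu in nuE.
have muE q := split_TF_dsection q Ft; rewrite -/mu in muE.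
apply: levi_inv_eq => [q|q Y FY].
  have [[nus En] _] := nuE q; have [mus Em] := muE q.
  split; first exact: vfB.
  by apply: filterS2 En Em => s; apply: subspaceB; exact: LE_subspace.
have [[nus En] nuY] := nuE q; have [mus Em] := muE q; have [Ys _] := FY.
have tr := reeb_tangent q; have tYm := vbracket_tangent Ys mus.
pose v := Y q (form_Q theta rho) *: r q + vbracket Y mu q.
have tv : tangent q v by apply: tangentD => //; exact: tangentZ.
have thv : theta q v = Y q (form_Q theta rho) + bracket_form theta Y mu q.
  by rewrite (formD ths) ?(formZ ths) ?form_reeb ?mulr1//; exact: tangentZ.
have piv : piQ L (nablaTF L theta t Y) q = tcoset (LH L q) v.
  rewrite /piQ; set C := nablaTF L theta t Y q.
  have : C (coset_repr C).
    (* The class [C] is the set of vectors with a prescribed splitting, so it must be shown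
       inhabited before its representative is used; [e] is the prescribed E-component. *)
    rewrite /coset_repr; apply: (xgetPex 0 (P := C)).
    pose e := nablaE L theta mu Y q +
      form_Q theta rho q *: Defs.compE L q (vbracket Y r q).
    have Ee : LE L q e.
      apply: subspaceD (LE_subspace L q) _ _; first exact: compE_LE.
      exact: subspaceZ (LE_subspace L q) (compE_LE L _ _).
    exists (theta q v *: r q + e); split.
      by apply: tangentD; [exact: tangentZ|exact: LH_tangent (LE_LH Ee)].
    rewrite split_vec_reeb//; congr pair.
    rewrite (coset_add_tcoset _ _ (LH_subspace L q)).
    apply/(tcoset_LHP thc) => //; first exact: tangentZ.
    by rewrite (formZ ths)// form_reeb mulr1.
  move=> [_ /(congr1 fst)/= ->].
  exact: (coset_add_tcoset _ _ (LH_subspace L q)).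
rewrite piv; apply/(leviP thc) => //; first exact: vfB.
rewrite (bracket_formBl ths)// nuY// thv; congr (_ + _).
by rewrite [in RHS](bracket_formC ths).
Qed.

Lemma canonical_lift_unique rho : qsection (LH L) rho ->
  unique (fun t => [/\ qsection (LF L) t, piQ L t = rho &
                       forall p, dstar L (nablaTF L theta t) p
                                 = tcoset (LF L p) 0])
    (canonical_lift rho).
Proof.
move=> Hrho; have cl := canonical_lift_lifting Hrho.
have Fc := lifting_qsection cl; have pc := lifting_piQ cl; split.
  split=> // p; rewrite dstar_nablaTF ?pc//.
  by rewrite split_canonical_lift//= subrr.
move=> t [Ft tr td]; apply/funext => p.
have fs q := form_Q_smooth q Hrho.
have [[_ /nbhs_singleton Enu] _] := nablaQ_levi_inv p fs.
have [_ /nbhs_singleton Emu] := split_TF_dsection p Ft.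
have [tt tE] := qsection_LF_repr p Ft.
(* The difference lies in E, and the vanishing of its class modulo F puts it in F. *)
have numu : levi_inv L (nablaQ L theta rho) p = (split_TF L theta t p).2.
  apply/eqP; rewrite -subr_eq0; apply/eqP; apply: (@LE_LF_eq0 _ _ _ L p).
    exact: subspaceB (LE_subspace L p) _ _.
  apply/(tcoset_eq0 _ (LF_subspace L p)).
  by rewrite -(td p) dstar_nablaTF ?tr.
rewrite /canonical_lift numu [RHS]tE.
apply/esym/(tcoset_eqP _ _ (LF_subspace L p)).
rewrite (form_Q_tcoset tt) -?tr//; exact: split_vecK.
Qed.

(** * Linearity and order of the lifting *)

Lemma lifting_linear c rho rho' t t' : lifting rho t -> lifting rho' t' ->
  lifting (qadd (qscale (LH L) (fun=> c) rho) rho')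
          (qadd (qscale (LF L) (fun=> c) t) t').
Proof.
move=> tl t'l p; have [X Xl] := tl p; have [X' X'l] := t'l p.
exists (fun q => c *: X q + X' q); near=> q.
have [Xs tX rX XY] : [/\ smooth_vf_at X q, t q = tcoset (LF L q) (X q),
        rho q = tcoset (LH L q) (X q) &
        forall Y, dsection_at (LF L) Y q -> LH L q (vbracket X Y q)] by near: q.
have [X's t'X' r'X' X'Y] : [/\ smooth_vf_at X' q, t' q = tcoset (LF L q) (X' q),
        rho' q = tcoset (LH L q) (X' q) &
        forall Y, dsection_at (LF L) Y q -> LH L q (vbracket X' Y q)] by near: q.
split.
- exact: (vf_lincomb (smooth_cst c q)).
- by rewrite /qadd /qscale tX t'X' coset_scale_tcoset ?coset_add_tcoset//;
    exact: LF_subspace.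
- by rewrite /qadd /qscale rX r'X' coset_scale_tcoset ?coset_add_tcoset//;
    exact: LH_subspace.
move=> Y FY; have [Ys _] := FY; apply: (form_eq0 thc).
  by apply: vbracket_tangent => //; exact: (vf_lincomb (smooth_cst c q)).
rewrite -/(bracket_form theta _ Y q).
rewrite (bracket_form_lincombl ths (smooth_cst c q))// /bracket_form.
rewrite (form_LH thc (XY Y FY)) (form_LH thc (X'Y Y FY)).
by rewrite (tangent_cst _ (vf_tangent Ys)) mulr0 mul0r subrr addr0.
Unshelve. all: by end_near. Qed.

(** With theta(X_h) = h theta(X) for a multiplier h, the field fg X + X_fg - f X_g - g X_f lies in
    H. Its bracket with Y in F has theta-value (- Y(fg) + g Y f + f Y g) theta(X), zero by the
    Leibniz rule, so its value at [p] lies in F. *)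
Lemma lifting_order (f g : M -> R) rho t tf tg tfg :
  smooth_fun f -> smooth_fun g -> lifting rho t ->
  lifting (qscale (LH L) f rho) tf -> lifting (qscale (LH L) g rho) tg ->
  lifting (qscale (LH L) (f * g) rho) tfg ->
  qadd tfg (qscale (LF L) (f * g) t) =
  qadd (qscale (LF L) f tg) (qscale (LF L) g tf).
Proof.
move=> fs gs tl tfl tgl tfgl; apply/funext => p.
have [X Xl] := tl p; have [Xf Xfl] := tfl p.
have [Xg Xgl] := tgl p; have [Xfg Xfgl] := tfgl p.
have [Xs tX rX XY] := nbhs_singleton Xl.
have [Xfs tXf _ XfY] := nbhs_singleton Xfl.
have [Xgs tXg _ XgY] := nbhs_singleton Xgl.
have [Xfgs tXfg _ XfgY] := nbhs_singleton Xfgl.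
have sF := LF_subspace L p.
rewrite /qadd /qscale tX tXf tXg tXfg !coset_scale_tcoset// !coset_add_tcoset//.
apply/(tcoset_eqP _ _ sF).
have fgs : smooth_at (f * g) p by exact: smoothM.
pose A q := (f * g) q *: X q + Xfg q.
(* The final zero field lets the formulas for [c *: u + v] apply at both levels. *)
pose B q := f q *: Xg q + (g q *: Xf q + (0 : vfield R M) q).
have B's : smooth_vf_at (fun q => g q *: Xf q + (0 : vfield R M) q) p.
  exact: (vf_lincomb (gs p) Xfs (vf0 p)).
have As : smooth_vf_at A p by exact: vf_lincomb.
have Bs : smooth_vf_at B p by exact: (vf_lincomb (fs p) Xgs B's).
rewrite (_ : _ - _ = (A - B) p); last first.
  by rewrite -[RHS]/(A p - B p) /A /B addr0 [(f * g) p *: _ + _]addrC.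
(* The relation is needed near [p], not only at [p], for [A - B] to be a local section of H. *)
have near_form (h : M -> R) (Xh : vfield R M) : smooth_fun h ->
    (\forall q \near p, qscale (LH L) h rho q = tcoset (LH L q) (Xh q)) ->
    smooth_vf_at Xh p ->
    \forall q \near p, theta q (Xh q) = h q * theta q (X q).
  move=> hs hX Xhs; near=> q.
  have [Xsq _ rXq _] : [/\ smooth_vf_at X q, t q = tcoset (LF L q) (X q),
        rho q = tcoset (LH L q) (X q) &
        forall Y, dsection_at (LF L) Y q -> LH L q (vbracket X Y q)] by near: q.
  have tXh : tangent q (Xh q) by apply: vf_tangent; near: q; exact: vf_near.
  have tXq := vf_tangent Xsq.
  rewrite -(formZ ths)//; apply/(tcoset_LHP thc tXh); first exact: tangentZ.
  have <- : qscale (LH L) h rho q = tcoset (LH L q) (Xh q) by near: q.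
  by rewrite /qscale rXq coset_scale_tcoset//; exact: LH_subspace.
have thXf : \forall q \near p, theta q (Xf q) = f q * theta q (X q).
  by apply: near_form => //; apply: filterS Xfl => q [].
have thXg : \forall q \near p, theta q (Xg q) = g q * theta q (X q).
  by apply: near_form => //; apply: filterS Xgl => q [].
have thXfg : \forall q \near p, theta q (Xfg q) = (f * g) q * theta q (X q).
  apply: near_form => //; last by apply: filterS Xfgl => q [].
  by move=> q; exact: smoothM.
apply: (LF_characterization thc) => [|Y FY].
  split; first exact: vfB.
  near=> q.
  have tXq : tangent q (X q) by apply: vf_tangent; near: q; exact: vf_near.
  have tXfq : tangent q (Xf q) by apply: vf_tangent; near: q; exact: vf_near.
  have tXgq : tangent q (Xg q) by apply: vf_tangent; near: q; exact: vf_near.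
  have tXfgq : tangent q (Xfg q) by apply: vf_tangent; near: q; exact: vf_near.
  have tAq : tangent q (A q) by exact: lincomb_tangent.
  have tB'q : tangent q (g q *: Xf q + 0).
    by apply: lincomb_tangent => //; exact: tangent0.
  have tBq : tangent q (B q) by exact: lincomb_tangent.
  apply: (form_eq0 thc); first exact: tangentB.
  rewrite (formB ths)// (form_linear ths)// (form_linear ths)//.
  rewrite (form_linear ths)//; last exact: tangent0.
  rewrite (form0 ths).
  have -> : theta q (Xf q) = f q * theta q (X q) by near: q.
  have -> : theta q (Xg q) = g q * theta q (X q) by near: q.
  have -> : theta q (Xfg q) = (f * g) q * theta q (X q) by near: q.
  rewrite -[(f * g) q]/(f q * g q); ring.
have [Ys _] := FY; have tY := vf_tangent Ys.
rewrite (bracket_formBl ths)// (bracket_form_lincombl ths)//.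
rewrite (bracket_form_lincombl ths (fs p))//.
rewrite (bracket_form_lincombl ths (gs p) Xfs (vf0 p))//.
have -> : bracket_form theta 0 Y p = 0.
  have := bracket_formBl ths Xs Xs Ys.
  by rewrite subrr subrr.
rewrite (tangent_leibniz tY)// (nbhs_singleton thXf) (nbhs_singleton thXg).
have b0 Z : (forall Y, dsection_at (LF L) Y p -> LH L p (vbracket Z Y p)) ->
    bracket_form theta Z Y p = 0.
  by move=> /(_ Y FY) /(form_LH thc).
rewrite (b0 X)// (b0 Xf)// (b0 Xg)// (b0 Xfg)//.
ring.
Unshelve. all: by end_near. Qed.

End contact_form_theory.
End reeb_and_lifts.
Arguments canonical_lift {R n M} L theta rho p.

(** * The operator on sections of Q *)

Lemma qscale_qsection (R : realType) (d : nat) (M : manifold R d)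
    (D : tfamily R M) (f : M -> R) t :
  (forall p, subspace (D p)) -> smooth_fun f -> qsection D t ->
  qsection D (qscale D f t).
Proof.
move=> sD fs Dt p; have [X Xs tX] := Dt p.
exists (fun q => f q *: X q); first exact: vfZ.
apply: filterS tX => q tq.
by rewrite /qscale tq coset_scale_tcoset.
Qed.

Lemma qadd_qsection (R : realType) (d : nat) (M : manifold R d)
    (D : tfamily R M) t u :
  (forall p, subspace (D p)) -> qsection D t -> qsection D u ->
  qsection D (qadd t u).
Proof.
move=> sD Dt Du p; have [X Xs tX] := Dt p; have [Y Ys uY] := Du p.
exists (X + Y); first exact: vfD.
apply: filterS2 tX uY => q tq uq.
by rewrite /qadd tq uq coset_add_tcoset.
Qed.

Theorem lemma3p1 (R : realType) (n : nat) (M : manifold R (2 * n).+1)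
    (L : legendrean M) (contact_forms_exist : exists theta, contact_form L theta) :
  exists S : tfamily R M -> tfamily R M,
    first_order_operator (LH L) (LF L) S /\
    forall theta, contact_form L theta ->
    forall rho, qsection (LH L) rho ->
      unique (fun t => [/\ qsection (LF L) t,
                           piQ L t = rho &
                           forall p, dstar L (nablaTF L theta t) p
                                     = tcoset (LF L p) 0])
             (S rho) /\
      (forall p, split_TF L theta (S rho) p
                 = (rho p, levi_inv L (nablaQ L theta rho) p)).
Proof.
have [theta0 thc0] := contact_forms_exist.
have sH := LH_subspace L; have cl := canonical_lift_lifting thc0.
exists (canonical_lift L theta0); split; last first.
  move=> theta thc rho Hrho.
  (* The lifts built from [theta0] and from [theta] lift the same section, so every claim can be
     checked on the second. *)
  rewrite (lifting_unique thc (cl rho Hrho) (canonical_lift_lifting thc Hrho)).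
  split; first exact: canonical_lift_unique.
  by move=> p; exact: split_canonical_lift.
split=> [t Ht|c t u Ht Hu|f g t fs gs Ht].
- exact: lifting_qsection (cl t Ht).
- have cs : smooth_fun (fun _ : M => c) by move=> p; exact: smooth_cst.
  (* Both sides of the linearity identity lift the same combination of [t] and [u]. *)
  apply: (lifting_unique thc0); last exact: (lifting_linear thc0 c (cl t Ht) (cl u Hu)).
  by apply/cl/qadd_qsection => //; exact: qscale_qsection.
- have fgs : smooth_fun (f * g) by move=> p; exact: smoothM.
  by apply: (lifting_order thc0 fs gs (cl t Ht)); apply: cl; exact: qscale_qsection.
Qed.
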